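(* Let $\{B^H(t), t\in[0,1]\}$ be a $d$-dimensional fractional Brownian motion with Hurst index $H\in(0,1)$, and let $\theta_H(x)=x^{2H+1}L_{\theta_H}(x)$ be a normalized regularly varying function at infinity (as described in the context) such that (i) $\liminf_{x\to+\infty}L_{\theta_H}(x)=0$ and $\limsup_{x\to+\infty}L_{\theta_H}(x)<+\infty$; (ii) $\limsup_{x\to+\infty}x\,\varepsilon_{\theta_H}'(x)=0$. Let $\ell_{\theta_H}(x)=\mathtt{c}_H^{1/2}L_{\theta_H}^{-1/2}(1/x)$ and $\mathsf{w}_{H,\ell_{\theta_H}}(x)=x^H\ell_{\theta_H}(x)\log^{1/2}(1/x)$ for $x\in(0,1]$, $\mathsf{w}_{H,\ell_{\theta_H}}(0)=0$. Then there exist a function $f\in C^{\mathsf{w}_{H,\ell_{\theta_H}}}(\mathbf{I})\setminus C^{H}(\mathbf{I})$ and compact sets $E\subset\mathbf{I}$ and $F\subset\mathbb{R}^d$ such that $$\mathcal{C}_{\rho_{\mathbf{d}_H}}^{d}(E\times F)=\mathcal{H}_{\rho_{\mathbf{d}_H}}^{d}(E\times F)=0\quad\text{and}\quad\mathbb{P}\{(B^H+f)(E)\cap F\neq\varnothing\}>0.$$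
   Context: $\mathbf{I}=[a,b]$ with fixed $0<a<b\le 1$. A real fractional Brownian motion $B_0^H$ is a centered Gaussian process with continuous paths and covariance $\frac12(|t|^{2H}+|s|^{2H}-|t-s|^{2H})$; $B^H=(B_1^H,\dots,B_d^H)$ has $d$ independent copies of $B_0^H$ as components and is defined on a complete probability space $(\Omega,\mathcal{F},\mathbb{P})$. The parabolic metric on $\mathbb{R}_+\times\mathbb{R}^d$ is $\rho_{\mathbf{d}_H}((s,x),(t,y))=\max\{|t-s|^H,\|x-y\|\}$. For a metric space $(\mathscr{X},\rho)$, $G\subset\mathscr{X}$ and $\beta>0$: $\mathcal{H}_\rho^\beta(G)=\lim_{\delta\to0}\inf\{\sum_{n}(2r_n)^\beta: G\subseteq\bigcup_{n} B_\rho(r_n),\ r_n\le\delta\}$, where $B_\rho(r)$ denotes an open ball of radius $r$; and $\mathcal{C}_\rho^\beta(G)=\big[\inf_{\mu\in\mathcal{P}(G)}\iint\rho(u,v)^{-\beta}\mu(du)\mu(dv)\big]^{-1}$, where $\mathcal{P}(G)$ is the set of (Borel) probability measures carried by $G$ (with $0^{-\beta}=\infty$, $1/\infty=0$). For a continuous $\mathsf{w}:[0,1]\to[0,\infty)$ with $\mathsf{w}(0)=0$, increasing near $0$, $C^{\mathsf{w}}(\mathbf{I})$ is the space of continuous $f:\mathbf{I}\to\mathbb{R}^d$ with $\sup_{s\ne t\in\mathbf{I}}\|f(s)-f(t)\|/\mathsf{w}(|s-t|)<\infty$. $C^H(\mathbf{I})$ is the case $\mathsf{w}(r)=r^H$ (Hölder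 functions of order $H$). Normalized regularly varying function at infinity: $\theta_H:\mathbb{R}_+\to\mathbb{R}_+$ is a $\mathcal{C}^\infty$ function with $\theta_H(x)=x^{2H+1}L_{\theta_H}(x)$, where $L_{\theta_H}(x)=\mathtt{c}_1\exp\left(\int_{x_0}^x\frac{\varepsilon_{\theta_H}(t)}{t}dt\right)$ for $x\ge x_0$ and $L_{\theta_H}(x)=\mathtt{c}_1$ for $x\in(0,x_0)$, with constants $\mathtt{c}_1,x_0>0$ and a bounded function $\varepsilon_{\theta_H}$ with $\varepsilon_{\theta_H}(t)\to0$ as $t\to\infty$; thus $\varepsilon_{\theta_H}(x)=xL_{\theta_H}'(x)/L_{\theta_H}(x)$ for $x\ge x_0$. The constant is $\mathtt{c}_H=\frac4\pi\int_0^\infty\frac{\sin^2(s/2)}{s^{2H+1}}ds$. *)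

(* Defs.v *)
From HB Require Import structures.
From mathcomp Require Import all_boot all_order all_algebra.
From mathcomp Require Import all_classical all_reals all_analysis.

Set Implicit Arguments.
Unset Strict Implicit.
Unset Printing Implicit Defensive.

Import Order.TTheory GRing.Theory Num.Theory.
Import numFieldNormedType.Exports.

Local Open Scope classical_set_scope.
Local Open Scope ring_scope.

(* The library norm on matrices is the sup norm. *)
Definition enorm (R : realType) (d : nat) (x : 'rV[R]_d) : R :=
  Num.sqrt (\sum_(j < d) x ord0 j ^+ 2).

(* normal_prob m 0 is a junk value in the library, hence the Dirac case. *)
Definition gaussian_law (R : realType) (m s : R) (A : set R) : \bar R :=
  if s == 0 then dirac m A else normal_prob m s A.

HB.instance Definition _ (T U : ptopologicalType) := Pointed.on (T * U)%type.

Section Process.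
Context (dO : measure_display) (Omega : measurableType dO) (R : realType).
Variable P : probability Omega R.

Definition gaussian_rv (X : Omega -> R) : Prop :=
  measurable_fun setT X /\
  exists m s : R, forall A : set R, measurable A ->
    P (X @^-1` A) = gaussian_law m s A.

Definition gaussian_process (T : set R) (X : R -> Omega -> R) : Prop :=
  forall (n : nat) (t c : 'I_n -> R), (forall i, T (t i)) ->
    gaussian_rv (fun w => \sum_(i < n) c i * X (t i) w).

Definition fbm_cov (H s t : R) : R :=
  2^-1 * (`|t| `^ (2 * H) + `|s| `^ (2 * H) - `|t - s| `^ (2 * H)).

Definition is_fbm1 (H : R) (X : R -> Omega -> R) : Prop :=
  [/\ gaussian_process `[0, 1] X,
      forall t, t \in `[0, 1] -> ('E_P[X t] = 0)%E,
      forall s t, s \in `[0, 1] -> t \in `[0, 1] ->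
        covariance P (X s) (X t) = (fbm_cov H s t)%:E
    & forall w, {within `[0, 1], continuous (fun t => X t w)}].

Definition process_sigma (T : set R) (X : R -> Omega -> R) :
    set (set Omega) :=
  <<s [set A | exists2 t, T t & exists2 C, measurable C & A = X t @^-1` C] >>.

Definition independent_processes (d : nat) (T : set R)
    (X : 'I_d -> R -> Omega -> R) : Prop :=
  forall (J : {set 'I_d}) (A : 'I_d -> set Omega),
    (forall j, j \in J -> process_sigma T (X j) (A j)) ->
    P (\bigcap_(j in [set j | j \in J]) A j) = (\prod_(j in J) P (A j))%E.

Definition is_fbm (d : nat) (H : R) (B : R -> Omega -> 'rV[R]_d) : Prop :=
  (forall j, is_fbm1 H (fun t w => B t w ord0 j)) /\
  independent_processes `[0, 1] (fun j t w => B t w ord0 j).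

End Process.

Section HausdorffCapacity.
Variable R : realType.

(* X is the carrier of the metric space: ball centres are taken in X.  The
   bound 0 <= r n allows empty balls, so that finite covers are included. *)
Definition hausdorff_content (T : Type) (X : set T) (rho : T -> T -> R)
    (beta : R) (G : set T) (delta : R) : \bar R :=
  ereal_inf [set s : \bar R | exists (c : nat -> T) (r : nat -> R),
    [/\ forall n, X (c n),
        forall n, 0 <= r n <= delta,
        G `<=` \bigcup_n [set u | X u /\ rho (c n) u < r n]
      & s = (\sum_(0 <= n <oo) ((2 * r n) `^ beta)%:E)%E]].

Definition hausdorff_measure (T : Type) (X : set T) (rho : T -> T -> R)
    (beta : R) (G : set T) : \bar R :=
  lim (hausdorff_content X rho beta G delta @[delta --> (0 : R)^'+]).

(* rho is meant to metrize the topology of T.  The inverses are those of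
   \bar R, for which 0^-1 = +oo and +oo^-1 = 0. *)
Definition energy (T : ptopologicalType) (rho : T -> T -> R) (beta : R)
    (mu : probability (g_sigma_algebraType (@open T)) R) : \bar R :=
  (\int[mu]_u \int[mu]_v ((rho u v `^ beta)%:E)^-1)%E.

Definition capacity (T : ptopologicalType) (rho : T -> T -> R) (beta : R)
    (G : set T) : \bar R :=
  ((ereal_inf [set energy rho beta mu |
      mu in [set mu : probability (g_sigma_algebraType (@open T)) R |
             mu.-negligible (~` G)]])^-1)%E.

Definition parabolic_space (d : nat) : set (R * 'rV[R]_d) :=
  [set u | 0 <= u.1].

Definition parabolic_dist (d : nat) (H : R) (u v : R * 'rV[R]_d) : R :=
  Num.max (`|v.1 - u.1| `^ H) (enorm (u.2 - v.2)).

End HausdorffCapacity.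

(* The quotient is taken in \bar R, so x / 0 = +oo for x > 0. *)
Definition modulus_space (R : realType) (d : nat) (w : R -> R) (I : set R)
    (f : R -> 'rV[R]_d) : Prop :=
  {within I, continuous f} /\
  (ereal_sup [set q : \bar R | exists s t : R, [/\ I s, I t, s != t &
      q = (enorm (f s - f t))%:E / (w `|s - t|)%:E]] < +oo)%E.

Definition holder_space (R : realType) (d : nat) (H : R) (I : set R)
    (f : R -> 'rV[R]_d) : Prop :=
  modulus_space (fun r => r `^ H) I f.

Section RegularVariation.
Variable R : realType.

(* Only the values of theta and L on the positive half-line matter, and those
   of eps on [x0, +oo[. *)
Definition normalized_regvar (H : R) (theta L eps : R -> R) (c1 x0 : R) :
    Prop :=
  [/\ 0 < c1 /\ 0 < x0,
      forall (n : nat) (x : R), 0 < x -> derivable (derive1n n theta) x 1,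
      forall x : R, 0 < x -> theta x = x `^ (2 * H + 1) * L x,
      (forall x : R, 0 < x < x0 -> L x = c1) /\
      (forall x : R, x0 <= x -> L x = c1 *
         expR (\int[lebesgue_measure]_(t in `[x0, x]) (eps t / t)))
    & [/\ exists M : R, forall x : R, x0 <= x -> `|eps x| <= M,
          eps x @[x --> +oo] --> (0 : R)
        & forall x : R, x0 <= x -> eps x = x * derive1 L x / L x]].

Definition c_fbm (H : R) : R :=
  4 / pi * \int[lebesgue_measure]_(s in `]0, +oo[)
             (sin (s / 2) ^+ 2 / s `^ (2 * H + 1)).

Definition ell (H : R) (L : R -> R) (x : R) : R :=
  Num.sqrt (c_fbm H) * (Num.sqrt (L x^-1))^-1.

(* Used on [0, 1] only. *)
Definition w_ell (H : R) (L : R -> R) (x : R) : R :=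
  if x == 0 then 0 else x `^ H * ell H L x * Num.sqrt (ln x^-1).

End RegularVariation.

(* Main.v *)
(* A function of modulus [x^H log^(1/2) (1/x)] oscillates more than fractional
   Brownian motion does, by an unbounded factor, at any prescribed sparse
   sequence of scales.  Choose scales [D_n] decreasing extremely fast and let
   the drift be a sum of triangle waves of amplitude [N_n D_n^H] whose [d]
   coordinates, of frequencies [1, N_n, ..., N_n^(d-1)], visit a grid of mesh
   [D_n^H] within time [D_n].  The times are restricted to a Cantor set [E]
   with windows of length about [D_n] at scale [n], and [F] keeps only the
   neighbourhoods, of size about [D_n^H], of the points of a lattice of mesh
   [N_n D_n^H] in each coordinate: the wave can always move the path into
   these neighbourhoods, so on an event of positive probability, on which the
   increments of the process between consecutive approximate times are
   controlled, a point of [E] where the drifted path lies in [F] is found scale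
   by scale.  Since [N_n] is chosen after everything else at scale [n] except
   [D_n], lattice counting shows that [E * F] is covered by [k] parabolic balls
   of radius [r] with [k r^d] arbitrarily small.  As [L] is bounded, the weight
   [ell] only enlarges the modulus space. *)

From HB Require Import structures.
Require Import Defs.
From mathcomp Require Import all_boot all_order all_algebra.
From mathcomp Require Import all_classical all_reals all_analysis.
From mathcomp Require Import measurable_realfun.
From mathcomp Require Import ring lra zify.

Set Implicit Arguments.
Unset Strict Implicit.
Unset Printing Implicit Defensive.

Import Order.TTheory GRing.Theory Num.Theory.
Import numFieldNormedType.Exports.

Local Open Scope classical_set_scope.
Local Open Scope ring_scope.

(** * Triangle wave and telescoping sequences *)

Section Wave.
Variable R : realType.
Implicit Types x y u : R.

(** The order of the choices at one scale carries the proof. The number of time windows, about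
    [(sig n)^-1], is settled by the previous scale, while in each coordinate the target occupies a
    proportion about [mu / N] of space; making [N] a large multiple of [mu] thus makes the cover as
    cheap as desired. The same choice keeps the union bound summable: a window has about [N ^ d]
    candidate times, a polynomial in [mu], against a Gaussian tail [expR (- mu ^+ 2 / 4)]. Only then
    is [D] taken small: the amplitude [N * D^H] fits below [x^H log^(1/2) (1/x)] once [log (1/D)]
    dominates powers of [N], whereas its ratio [N] to [D^H] is unbounded, which excludes the drift
    from [C^H]. The time found by the search depends on the path, so increments are controlled
    between all pairs of lattice times that the search may select; after that, the argument is
    deterministic, path by path. *)

Definition tri_wave x : R := `|x - 2 * (Num.floor ((x + 1) / 2))%:~R|.

(** The wave is the distance to the even integers; being a minimum of the functions on the right, it
    is 1-Lipschitz like each of them. *)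
Lemma tri_wave_le x (n : int) : tri_wave x <= `|x - 2 * n%:~R|.
Proof.
rewrite /tri_wave; set m := Num.floor _.
have /andP[h1 h2] : m%:~R <= (x + 1) / 2 < (m + 1)%:~R by exact: floor_itv.
rewrite intrD in h2.
have h3 : `|x - 2 * m%:~R| <= 1 by rewrite ler_norml; apply/andP; split; lra.
have [nm|nm|->//] := ltgtP n m.
- have : (n + 1)%:~R <= m%:~R :> R by rewrite ler_int lezD1.
  rewrite intrD => h; apply: (le_trans h3); rewrite ler_normr; apply/orP; left; lra.
- have : (m + 1)%:~R <= n%:~R :> R by rewrite ler_int lezD1.
  rewrite intrD => h; apply: (le_trans h3); rewrite ler_normr; apply/orP; right; lra.
Qed.

Lemma tri_wave_ge0 x : 0 <= tri_wave x. Proof. exact: normr_ge0. Qed.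

Lemma tri_wave_le1 x : tri_wave x <= 1.
Proof.
rewrite /tri_wave; set m := Num.floor _.
have /andP[h1 h2] : m%:~R <= (x + 1) / 2 < (m + 1)%:~R by exact: floor_itv.
by rewrite intrD in h2; rewrite ler_norml; apply/andP; split; lra.
Qed.

Lemma tri_wave_lip x y : `|tri_wave x - tri_wave y| <= `|x - y|.
Proof.
suff h a b : tri_wave a - tri_wave b <= `|a - b|.
  rewrite ler_norml; apply/andP; split; last exact: h.
  by rewrite lerNl opprB distrC; exact: h.
rewrite lerBlDr {2}/tri_wave; set m := Num.floor _.
by apply: (le_trans (tri_wave_le a m)); rewrite (le_trans _ (ler_normD _ _))// addrA subrK.
Qed.

Lemma tri_waveE (n : int) u : 0 <= u <= 1 -> tri_wave (2 * n%:~R + u) = u.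
Proof.
move=> /andP[u0 u1]; apply/eqP; rewrite eq_le; apply/andP; split.
  by have := tri_wave_le (2 * n%:~R + u) n; rewrite addrAC subrr add0r (ger0_norm u0).
rewrite /tri_wave; set m := Num.floor _.
have [nm|nm|<-] := ltgtP n m; last by rewrite addrAC subrr add0r ger0_norm.
- have : (n + 1)%:~R <= m%:~R :> R by rewrite ler_int lezD1.
  by rewrite intrD => h; rewrite ler_normr; apply/orP; right; lra.
- have : (m + 1)%:~R <= n%:~R :> R by rewrite ler_int lezD1.
  by rewrite intrD => h; rewrite ler_normr; apply/orP; left; lra.
Qed.

(* The slow coordinate is adjusted first; the later adjustments disturb each
   coordinate by at most [4 / N]. *)
Lemma tri_wave_digits (N n : nat) (u : nat -> R) x : (1 < N)%N -> 0 <= x ->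
  (forall j, 0 <= u j <= 1) ->
  exists k : nat, x <= k%:R / N%:R ^+ n <= x + 4 /\
   forall j, (j < n)%N -> `|tri_wave (N%:R ^+ j * (k%:R / N%:R ^+ n)) - u j| <= 4 / N%:R.
Proof.
move=> N1; have N2 : 2 <= N%:R :> R by rewrite ler_nat.
have N0 : 0 < N%:R :> R by lra.
elim: n u x => [|n IH] u x x0 hu.
  exists (Num.truncn x).+1; rewrite expr0 divr1; split=> //.
  have /andP[h1 h2] := truncn_itv x0.
  by rewrite ltW//=; move: h1; rewrite -natr1; lra.
(* [y] is the first point after [x] on a rising branch where the slow wave equals [u 0]. The faster
   waves are searched from [N * y] on; their overshoot [4 / N <= 2] keeps the total displacement
   below 4. *)
pose m := Num.ceil ((x - u 0%N) / 2).
have h1 : (m - 1)%:~R < (x - u 0%N) / 2 <= m%:~R by exact: ceil_itv.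
pose y := 2 * m%:~R + u 0%N.
have xy : x <= y <= x + 2.
  by move: h1; rewrite intrB /y => /andP[? ?]; apply/andP; split; lra.
have [||k [kb hk]] := IH (u \o S) (N%:R * y).
- by rewrite mulr_ge0 ?ler0n//; lra.
- by move=> j; exact: hu.
have e : N%:R * (k%:R / N%:R ^+ n.+1) = k%:R / N%:R ^+ n :> R.
  by rewrite exprS invfM mulrCA mulVKf ?gt_eqF.
move: kb; rewrite -e => /andP[kb1 kb2].
set z := _ / _ in kb1 kb2 *.
have yz : y <= z by rewrite ler_pM2l in kb1.
have zy : z <= y + 4 / N%:R.
  by rewrite -(ler_pM2l N0) mulrDr [N%:R * (4 / _)]mulrC divfK ?gt_eqF.
have N4 : 4 / N%:R <= 2 :> R by rewrite ler_pdivrMr//; lra.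
exists k; split; first by rewrite -/z; lra.
case=> [_|j jn].
  rewrite expr0 mul1r -/z; rewrite -[X in _ - X](tri_waveE m (hu 0%N)) -/y.
  apply: (le_trans (tri_wave_lip _ _)); rewrite ger0_norm; lra.
by rewrite exprSr -mulrA; have := hk j jn; rewrite /= -e.
Qed.

End Wave.

Section Telescope.
Variable R : realType.
Implicit Types (u e : nat -> R).

Lemma telescope_le u e m : (forall n, `|u n.+1 - u n| <= e n) ->
  (forall n, e n.+1 <= e n / 2) ->
  forall n, (m <= n)%N -> `|u n - u m| <= 2 * e m.
Proof.
move=> ue e2 n /subnK <-; set k := (n - m)%N.
have e0 i : 0 <= e i by exact: le_trans (ue i).
suff h i j : `|u (i + j)%N - u j| <= 2 * e j by exact: h.
elim: i j => [|i IH] j; first by rewrite subrr normr0 mulr_ge0.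
have -> : u (i.+1 + j)%N - u j = (u (i + j.+1)%N - u j.+1) + (u j.+1 - u j).
  by rewrite addrA subrK addSnnS.
apply: (le_trans (ler_normD _ _)); have := IH j.+1; have := ue j; have := e2 j; lra.
Qed.

Lemma geom_le e m n : (forall n, 0 <= e n) -> (forall n, e n.+1 <= e n / 2) ->
  (m <= n)%N -> e n <= e m / 2 ^+ (n - m).
Proof.
move=> e0 e2 /subnK <-; rewrite addnK; elim: (n - m)%N => [|k IH].
  by rewrite expr0 divr1.
rewrite addSn (le_trans (e2 _))// exprSr invfM mulrA ler_pM2r//; lra.
Qed.

Lemma geom_cvg0 e : (forall n, 0 <= e n) -> (forall n, e n.+1 <= e n / 2) ->
  e n @[n --> \oo] --> (0 : R).
Proof.
move=> e0 e2; apply: (@squeeze_cvgr _ _ _ _ (fun=> 0) (fun n => e 0%N * (1 / 2) ^+ n)).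
- near=> n; rewrite e0/= (le_trans (geom_le e0 e2 (leq0n n)))//.
  by rewrite subn0 expr_div_n expr1n mul1r.
- exact: cvg_cst.
- rewrite -[X in _ --> X](mulr0 (e 0%N)); apply: cvgMr.
  by apply: cvg_expr; rewrite ger0_norm; lra.
Unshelve. all: by end_near. Qed.

Lemma telescope_cvg u e : (forall n, `|u n.+1 - u n| <= e n) ->
  (forall n, e n.+1 <= e n / 2) -> exists2 l, u n @[n --> \oo] --> l &
   forall m, `|l - u m| <= 2 * e m.
Proof.
move=> ue e2.
have e0 i : 0 <= e i by exact: le_trans (ue i).
have ecvg := geom_cvg0 e0 e2.
have tl := telescope_le ue e2.
have cu : cvgn u.
  apply/cauchy_cvgP/cauchy_exP => /= eps eps0.
  have [n _ /(_ n (leqnn n)) /= hn] : \forall n \near \oo, 2 * e n < eps.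
    have : 2 * e n @[n --> \oo] --> (2 * 0 : R) by exact: cvgMr.
    by rewrite mulr0 => /cvgr_lt; apply.
  exists (u n); exists n => // k /= nk; rewrite /ball/= distrC.
  exact: le_lt_trans (tl n k nk) hn.
exists (limn u) => // m.
have /cvg_lim <- // : `|u n - u m| @[n --> \oo] --> `|limn u - u m|.
  by apply: cvg_norm; apply: cvgB => //; exact: cvg_cst.
apply: limr_le; first by apply: is_cvg_norm; apply: is_cvgB => //; exact: is_cvg_cst.
by exists m => // k /= mk; exact: tl.
Qed.

End Telescope.

(** * Gaussian tails *)

Lemma measurable_gt_set (R : realType) d (T : measurableType d) (g : T -> R) (c : R) :
  measurable_fun setT g -> measurable [set x | c < g x].
Proof.
move=> mg; rewrite -[X in measurable X]setTI.
rewrite (_ : [set x | c < g x] = g @^-1` `]c, +oo[); first exact: mg.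
by apply/seteqP; split => x /=; rewrite in_itv/= andbT.
Qed.

Lemma measurable_ge_set (R : realType) d (T : measurableType d) (g : T -> R) (c : R) :
  measurable_fun setT g -> measurable [set x | c <= g x].
Proof.
move=> mg; rewrite -[X in measurable X]setTI.
rewrite (_ : [set x | c <= g x] = g @^-1` `[c, +oo[); first exact: mg.
by apply/seteqP; split => x /=; rewrite in_itv/= andbT.
Qed.

Section Normal.
Variable R : realType.
Implicit Types m s mu c x : R.
Local Notation leb := (@lebesgue_measure R).

Lemma normal_peak_le s : s != 0 -> normal_peak s <= (2 * `|s|)^-1.
Proof.
move=> s0; have sgt : 0 < `|s| by rewrite normr_gt0.
rewrite /normal_peak lef_pV2 ?posrE ?mulr_gt0//; last first.
  by rewrite sqrtr_gt0 mulrn_wgt0// mulr_gt0 ?pi_gt0// exprn_even_gt0.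
rewrite -[leLHS]ger0_norm ?mulr_ge0// -sqrtr_sqr ler_sqrt; last first.
  by rewrite mulrn_wge0// mulr_ge0 ?sqr_ge0 ?pi_ge0.
rewrite exprMn real_normK ?num_real// -mulrnAr [leLHS]mulrC ler_wpM2l ?sqr_ge0//.
by have := pi_ge2 R; lra.
Qed.

Lemma normal_prob_itv_le m s c : s != 0 -> 0 <= c ->
  (normal_prob m s `[(- c)%R, c]%classic <= (c / `|s|)%:E)%E.
Proof.
move=> s0 c0; have sgt : 0 < `|s| by rewrite normr_gt0.
rewrite /normal_prob.
apply: (@le_trans _ _ (\int[leb]_(x in `[(- c)%R, c]%classic) (((2 * `|s|)^-1)%:E))%E).
  apply: ge0_le_integral => //=.
  - by move=> x _; rewrite lee_fin normal_pdf_ge0.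
  - by apply/measurable_EFinP; apply: measurable_funTS; exact: measurable_normal_pdf.
  - by move=> x _; rewrite lee_fin (le_trans (normal_pdf_ub m x s0))// normal_peak_le.
rewrite integral_cst//= lebesgue_measure_itv/= lte_fin.
case: ifPn => _; last by rewrite mule0 lee_fin divr_ge0.
rewrite -EFinB -EFinM lee_fin opprK le_eqVlt; apply/orP; left; apply/eqP.
by field; rewrite gt_eqF.
Qed.

(* On the tail, the density is at most [2 * expR (- mu ^+ 2 / 4)] times the
   normal density with twice the standard deviation. *)
Lemma normal_prob_tail m s mu : s != 0 -> 0 <= mu ->
  (normal_prob m s [set x | (mu * `|s| < `|x - m|)%R]%classic
     <= (2 * expR (- mu ^+ 2 / 4))%:E)%E.
Proof.
move=> s0 mu0; have sgt : 0 < `|s| by rewrite normr_gt0.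
have s20 : 2 * s != 0 by rewrite mulf_neq0// pnatr_eq0.
set A := [set x | _].
have mA : measurable A.
  apply: measurable_gt_set.
  by apply: measurableT_comp => //; exact: measurable_funB.
have e0 : 0 <= 2 * expR (- mu ^+ 2 / 4) by rewrite mulr_ge0// expR_ge0.
rewrite /normal_prob.
apply: (@le_trans _ _ (\int[leb]_(x in A)
    ((2 * expR (- mu ^+ 2 / 4))%:E * (normal_pdf m (2 * s) x)%:E))%E).
  apply: ge0_le_integral => //=.
  - by move=> x _; rewrite lee_fin normal_pdf_ge0.
  - by apply/measurable_EFinP; apply: measurable_funTS; exact: measurable_normal_pdf.
  - apply/measurable_EFinP; apply: measurable_funTS; apply: measurable_funM => //.
    exact: measurable_normal_pdf.
  - move=> x; rewrite /A /= => xA.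
    rewrite -EFinM lee_fin !normal_pdfE// /normal_fun.
    have -> : normal_peak (2 * s) = normal_peak s / 2.
      rewrite /normal_peak -invfM; congr (_^-1).
      have -> : (2 * s) ^+ 2 * pi *+ 2 = 2 ^+ 2 * (s ^+ 2 * pi *+ 2) :> R.
        by rewrite exprMn mulrnAr mulrA.
      by rewrite sqrtrM ?sqr_ge0// sqrtr_sqr ger0_norm// mulrC.
    have -> : 2 * expR (- mu ^+ 2 / 4) * (normal_peak s / 2 *
       expR (- (x - m) ^+ 2 / ((2 * s) ^+ 2 *+ 2))) =
      normal_peak s * (expR (- mu ^+ 2 / 4) * expR (- (x - m) ^+ 2 / ((2 * s) ^+ 2 *+ 2))).
      by field.
    rewrite ler_wpM2l ?normal_peak_ge0// -expRD ler_expR.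
    have s2 : 0 < s ^+ 2 by rewrite exprn_even_gt0.
    have h : mu ^+ 2 * s ^+ 2 <= (x - m) ^+ 2.
      rewrite -(real_normK (num_real s)) -(real_normK (num_real (x - m))) -exprMn.
      by rewrite ler_sqr ?nnegrE ?mulr_ge0// ltW.
    (* The two exponents differ by 3/8 of the squared normalized deviation, which is at least
       [mu ^+ 2 / 4] on the tail. *)
    rewrite -subr_ge0.
    have -> : - mu ^+ 2 / 4 + - (x - m) ^+ 2 / ((2 * s) ^+ 2 *+ 2)
         - - (x - m) ^+ 2 / (s ^+ 2 *+ 2)
       = ((x - m) ^+ 2 * 3 / 8 - mu ^+ 2 * s ^+ 2 / 4) / s ^+ 2 by field; rewrite ?s0 ?gt_eqF.
    by rewrite divr_ge0 ?(ltW s2)//; have := sqr_ge0 (x - m); lra.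
rewrite ge0_integralZl//=; last 2 first.
- by apply/measurable_EFinP; apply: measurable_funTS; exact: measurable_normal_pdf.
- by move=> x _; rewrite lee_fin normal_pdf_ge0.
rewrite -[leRHS]mule1 lee_wpmul2l ?lee_fin//.
rewrite -(integral_normal_pdf m (2 * s)); apply: ge0_subset_integral => //=.
- by apply/measurable_EFinP; exact: measurable_normal_pdf.
- by move=> x _; rewrite lee_fin normal_pdf_ge0.
Qed.

End Normal.

Section GaussianTail.
Context (dO : measure_display) (Omega : measurableType dO) (R : realType).
Variable P : probability Omega R.
Local Open Scope ereal_scope.

(* The parameters [m] and [s] of the law are not computed: by Chebyshev's
   inequality, [- 2 v, 2 v] has mass at least 3/4, hence [`|s| <= 3 * v] and
   [`|m| <= 11 * v], whence the constants. *)
Lemma gaussian_tail (Y : Omega -> R) (v mu : R) : gaussian_rv P Y ->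
  'E_P[Y] = 0 -> 'V_P[Y] = (v ^+ 2)%:E -> (0 < v)%R -> (0 <= mu)%R ->
  P [set w | ((11 + 3 * mu) * v < `|Y w|)%R] <= (2 * expR (- mu ^+ 2 / 4))%:E.
Proof.
move=> [mY [m [s law]]] EY VY v0 mu0.
have cheb : P [set w | (2 * v <= `|Y w|)%R] <= (4^-1)%:E.
  pose X : {RV P >-> R} := HB.pack Y (isMeasurableFun.Build _ _ _ _ Y mY).
  have := @chebyshev _ _ _ P X (2 * v)%R; rewrite EY VY /= => /(_ _)/le_trans.
  rewrite (_ : [set x | _] = [set w | (2 * v <= `|Y w|)%R]); last first.
    by apply: eq_set => w; rewrite subr0.
  apply; first by rewrite mulr_gt0.
  rewrite -EFinM lee_fin exprMn invfM -mulrA mulVf ?mulr1 ?expf_neq0 ?gt_eqF//.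
  by rewrite lef_pV2 ?posrE; lra.
have mI : measurable (`[(- (2 * v))%R, (2 * v)%R]%classic : set R) by [].
have conc : (3 / 4)%:E <= gaussian_law m s `[(- (2 * v))%R, (2 * v)%R]%classic.
  rewrite -law//.
  have -> : Y @^-1` `[(- (2 * v))%R, (2 * v)%R] = ~` [set w | (2 * v < `|Y w|)%R].
    apply/seteqP; split => w /=; rewrite in_itv/= -ler_norml.
      by move=> h; apply/negP; rewrite -leNgt.
    by move/negP; rewrite -leNgt.
  have mB : measurable [set w | (2 * v < `|Y w|)%R].
    apply: measurable_gt_set.
    exact: measurableT_comp.
  rewrite probability_setC// leeBrDr ?fin_num_measure//.
  have : P [set w | (2 * v < `|Y w|)%R] <= (4^-1)%:E.
    apply: le_trans cheb; apply: le_measure; rewrite ?inE//.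
      apply: measurable_ge_set.
      exact: measurableT_comp.
    by move=> w /ltW.
  move=> h; rewrite -[leRHS](_ : (3 / 4)%:E + (4^-1)%:E = 1); last first.
    by rewrite -EFinD; congr (_%:E); lra.
  exact: leeD.
have mT r : measurable [set x : R | (r < `|x|)%R].
  by apply: measurable_gt_set.
rewrite (_ : [set w | _] = Y @^-1` [set x | ((11 + 3 * mu) * v < `|x|)%R])//.
rewrite law//; move: conc; rewrite /gaussian_law.
have [_|s0] := eqVneq s 0%R.
  rewrite !diracE; case: (boolP (m \in _)) => [|_]; last first.
    by move=> h; exfalso; move: h; rewrite lee_fin mulr0n; lra.
  rewrite inE /= in_itv /= -ler_norml => mv _.
  rewrite memNset /=; first by rewrite lee_fin mulr_ge0// expR_ge0.
  by apply/negP; rewrite -leNgt (le_trans mv)// ler_pM2r//; lra.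
have sgt : (0 < `|s|)%R by rewrite normr_gt0.
move=> conc.
have sv : (`|s| <= 3 * v)%R.
  have := le_trans conc (@normal_prob_itv_le _ m s (2 * v)%R s0 _).
  rewrite lee_fin => /(_ _); rewrite ler_pdivlMr// => h.
  by have : (3 / 4 * `|s| <= 2 * v)%R; [apply: h; lra | lra].
(* Otherwise [[- 2 v, 2 v]] lies more than [9 v], hence more than three standard deviations, away
   from [m], and its mass is at most [2 * expR (- 9 / 4) <= 8 / 13 < 3 / 4]. *)
have mv : (`|m| <= 11 * v)%R.
  rewrite leNgt; apply/negP => mv.
  have : normal_prob m s `[(- (2 * v))%R, (2 * v)%R]%classic <= (2 * expR (- 3 ^+ 2 / 4))%:E.
    apply: le_trans (@normal_prob_tail _ m s 3 s0 _); last by [].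
    apply: le_measure; rewrite ?inE//.
      apply: measurable_gt_set.
      by apply: measurableT_comp => //; exact: measurable_funB.
    move=> x /=; rewrite in_itv/= -ler_norml => xv.
    have : (`|m| <= `|x| + `|x - m|)%R.
      by rewrite -{1}(subKr x m) (le_trans (ler_normB _ _)).
    lra.
  move=> /(le_trans conc); rewrite lee_fin leNgt => /negP; apply.
  have -> : (- 3 ^+ 2 / 4 = - (9 / 4) :> R)%R by field.
  have h := @expR_ge1Dx R (9 / 4).
  have : ((expR (9 / 4))^-1 <= (13 / 4 : R)^-1)%R by rewrite lef_pV2 ?posrE ?expR_gt0//; lra.
  by rewrite expRN; lra.
apply: le_trans (@normal_prob_tail _ m s mu s0 mu0).
apply: le_measure; rewrite ?inE; [exact: mT| |].
  apply: measurable_gt_set.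
  by apply: measurableT_comp => //; exact: measurable_funB.
move=> x /= xv.
have : (`|x| <= `|m| + `|x - m|)%R.
  by rewrite -{1}(subrK m x) addrC (le_trans (ler_normD _ _)).
have : (mu * `|s| <= mu * (3 * v))%R by rewrite ler_wpM2l.
lra.
Qed.

End GaussianTail.

Lemma powR_sqr (R : realType) (t h : R) : 0 <= t -> (t `^ h) ^+ 2 = t `^ (2 * h).
Proof. by move=> t0; rewrite [2 * h]mulrC powRrM powR_mulrn ?powR_ge0. Qed.

(** * Moments and tails of fractional Brownian motion *)

Section FractionalBrownian.
Context (dO : measure_display) (Omega : measurableType dO) (R : realType).
Variable P : probability Omega R.
Variables (H : R) (X : R -> Omega -> R).
Hypotheses (H_gt0 : 0 < H) (X_fbm : is_fbm1 P H X).

Lemma fbm_measurable t : t \in `[0, 1] -> measurable_fun setT (X t).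
Proof.
move=> t01; have [gp _ _ _] := X_fbm.
have [/= + _] := gp 1%N (fun=> t) (fun=> 1) (fun=> t01).
by under eq_fun do rewrite big_ord1 mul1r.
Qed.

Lemma fbm_cov_diag t : 0 <= t -> fbm_cov H t t = (t `^ H) ^+ 2.
Proof.
move=> t0; rewrite /fbm_cov subrr normr0 powR0 ?mulf_neq0 ?pnatr_eq0 ?gt_eqF//.
by rewrite ger0_norm// subr0 powR_sqr//; lra.
Qed.

(** Square integrability is read off the covariance: the process is centered, so the second moment
    is [fbm_cov H t t], a real number. *)
Lemma fbm_Lfun2 t : t \in `[0, 1] -> X t \in Lfun P 2%:E.
Proof.
move=> t01; have [_ EX covX _] := X_fbm.
have mX := fbm_measurable t01.
rewrite inE; apply/andP; split; rewrite inE//= /finite_norm unlock /Lnorm poweR_lty//.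
have := covX _ _ t01 t01; rewrite unlock EX//= unlock => e.
rewrite (_ : \int[P]_x _ = (fbm_cov H t t)%:E)%E ?ltry// -e.
apply: eq_integral => w _ /=.
rewrite powR_mulrn// real_normK ?num_real// expr2; congr (_%:E).
by rewrite -[RHS]/((X t w - 0) * (X t w - 0)) subr0.
Qed.

Lemma fbm_variance t : t \in `[0, 1] -> ('V_P[X t] = ((t `^ H) ^+ 2)%:E)%E.
Proof.
move=> t01; have [_ _ covX _] := X_fbm.
rewrite /variance covX// fbm_cov_diag//.
by move: t01; rewrite in_itv/= => /andP[].
Qed.

Lemma fbm_variance_incr s t : s \in `[0, 1] -> t \in `[0, 1] ->
  ('V_P[(X t \- X s)%R] = ((`|t - s| `^ H) ^+ 2)%:E)%E.
Proof.
move=> s01 t01; have [_ _ covX _] := X_fbm.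
rewrite varianceB ?fbm_Lfun2// !fbm_variance// covX//.
transitivity (((t `^ H) ^+ 2 + (s `^ H) ^+ 2 - 2 * fbm_cov H t s)%:E); first by [].
congr (_%:E); rewrite /fbm_cov.
move: s01 t01; rewrite !in_itv/= => /andP[s0 _] /andP[t0 _].
by rewrite !powR_sqr// (ger0_norm t0) (ger0_norm s0) (distrC s t); field.
Qed.

Lemma fbm_tail t mu : 0 < t <= 1 -> 0 <= mu ->
  (P [set w | ((11 + 3 * mu) * (t `^ H) < `|X t w|)%R] <= (2 * expR (- mu ^+ 2 / 4))%:E)%E.
Proof.
move=> /andP[t0 t1] mu0; have t01 : t \in `[0, 1] by rewrite in_itv/= ltW.
have [gp EX _ _] := X_fbm.
apply: gaussian_tail => //.
- have := gp 1%N (fun=> t) (fun=> 1) (fun=> t01).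
  by under eq_fun do rewrite big_ord1 mul1r.
- exact: EX.
- exact: fbm_variance.
- by rewrite powR_gt0.
Qed.

Lemma fbm_incr_tail s t mu : s \in `[0, 1] -> t \in `[0, 1] -> 0 <= mu ->
  (P [set w | ((11 + 3 * mu) * (`|t - s| `^ H) < `|X t w - X s w|)%R]
     <= (2 * expR (- mu ^+ 2 / 4))%:E)%E.
Proof.
move=> s01 t01 mu0; have [gp EX _ _] := X_fbm.
have [->|st] := eqVneq t s.
  rewrite (_ : [set w | _] = set0).
    by rewrite measure0 lee_fin mulr_ge0// expR_ge0.
  apply/seteqP; split => // w /=.
  by rewrite !subrr normr0 powR0 ?gt_eqF// mulr0 ltxx.
apply: (@gaussian_tail _ _ _ _ (X t \- X s)) => //.
- have T (i : 'I_2) : `[0, 1]%classic (if i == ord0 then t else s) by case: ifP.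
  have := gp 2%N _ (fun i => if i == ord0 then 1 else -1) T.
  by under eq_fun do rewrite big_ord_recl big_ord1 /= mul1r mulN1r.
- have L1 u : u \in `[0, 1] -> X u \in Lfun P 1.
    by move=> u01; apply: Lfun_subset12; rewrite ?fin_num_measure// fbm_Lfun2.
  by rewrite expectationB ?L1// !EX// sube0.
- exact: fbm_variance_incr.
- by rewrite powR_gt0// normr_gt0 subr_eq0.
Qed.

End FractionalBrownian.

(** * The constant of fractional Brownian motion *)

Section FbmConstant.
Variable R : realType.
Local Notation leb := (@lebesgue_measure R).

Lemma exists_pow2_itv (s : R) : 1 <= s -> exists n : nat, 2 ^+ n <= s < 2 ^+ n.+1.
Proof.
move=> s1; have s0 : 0 <= s by lra.
pose p := fun n => s < 2 ^+ n.
have ex : exists n, p n.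
  exists (Num.truncn s).+1; have /andP[_ h] := truncn_itv s0.
  apply: (lt_le_trans h); rewrite -natrX ler_nat; apply: ltnW; exact: ltn_expl.
case: (ex_minnP ex) => -[|n]; first by rewrite /p expr0; lra.
move=> pn hmin; exists n; apply/andP; split; last exact: pn.
by rewrite leNgt; apply/negP => /hmin; rewrite ltnn.
Qed.

Lemma sum_geometric_le (C q : R) n : 0 <= C -> 0 <= q < 1 ->
  \sum_(0 <= i < n) (C * q ^+ i) <= C / (1 - q).
Proof.
move=> C0 /andP[q0 q1]; have q1' : 0 < 1 - q by lra.
suff h : \sum_(0 <= i < n) (C * q ^+ i) = C * (1 - q ^+ n) / (1 - q).
  rewrite h ler_pM2r ?invr_gt0// ler_piMr// lerBlDr lerDl exprn_ge0//.
elim: n => [|n IH]; first by rewrite big_nil expr0 subrr mulr0 mul0r.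
rewrite big_nat_recr//= IH exprS; field; rewrite gt_eqF//.
Qed.

Lemma sqr_sin_le (x : R) : 0 <= x -> sin x ^+ 2 <= x ^+ 2.
Proof.
rewrite le_eqVlt => /predU1P[<-|x0]; first by rewrite sin0.
have [|c _] := @MVT R sin cos 0 x x0 (fun y _ => is_derive_sin y).
  by apply: continuous_subspaceT; exact: continuous_sin.
by rewrite sin0 !subr0 => ->; rewrite exprMn ler_piMl ?sqr_ge0.
Qed.

Variable H : R.
Hypotheses H01 : 0 < H < 1.

Let g (s : R) : R := sin (s / 2) ^+ 2 / s `^ (2 * H + 1).
Let Q : R := 2 `^ (2 * H).

Let g_ge0 s : 0 <= g s.
Proof. by rewrite divr_ge0 ?sqr_ge0 ?powR_ge0. Qed.

Let measurable_g (D : set R) : measurable D -> measurable_fun D g.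
Proof.
move=> mD; apply: measurable_funTS; apply: measurable_funM.
  apply: measurable_funX; apply: measurableT_comp.
    by apply: continuous_measurable_fun; exact: continuous_sin.
  exact: measurable_funM.
rewrite (_ : (fun s => _) = fun s => s `^ (- (2 * H + 1))).
  exact: measurable_powR.
by apply/funext => s; rewrite powRN.
Qed.

(** The range of [H] enters here: [Q < 4] gives convergence of the integral at 0, and [1 < Q]
    convergence at infinity. *)
Let Q_bounds : 1 < Q < 4.
Proof.
case/andP: H01 => H0 H1; apply/andP; split.
  by rewrite -[ltLHS](powRr0 2) /Q /powR pnatr_eq0/= ltr_expR ltr_pM2r ?ln_gt0//; lra.
rewrite (_ : 4 = 2 `^ 2); last by rewrite powR_mulrn//; lra.
by rewrite /Q /powR pnatr_eq0/= ltr_expR ltr_pM2r ?ln_gt0//; lra.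
Qed.

Let powRV (x h : R) : 0 < x -> x^-1 `^ h = (x `^ h)^-1.
Proof. by move=> x0; rewrite -powR_inv1 ?(ltW x0)// -powRrM mulN1r powRN. Qed.

Let powQ n : (2 ^+ n : R) `^ (2 * H) = Q ^+ n.
Proof.
have -> : 2 ^+ n = 2 `^ n%:R :> R by rewrite powR_mulrn.
by rewrite -powRrM mulrC powRrM powR_mulrn ?powR_ge0.
Qed.

(* Dyadic majorant of the integrand, by [clo n] on [2^-(n+1), 2^-n] and by
   [chi n] on [2^n, 2^(n+1)]; its integrals are the geometric terms
   [Q * (Q / 4) ^+ n] and [2 * Q^-1 ^+ n]. *)
Let lo n : set R := `]0, (2 ^+ n)^-1].
Let hi n : set R := `]0, 2 ^+ n.+1].
Let clo n : R := Q ^+ n.+1 / 2 ^+ n.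
Let chi n : R := (Q ^+ n * 2 ^+ n)^-1.
Let maj n (s : R) : \bar R := ((clo n * \1_(lo n) s + chi n * \1_(hi n) s)%:E).

Let clo_ge0 n : 0 <= clo n.
Proof. by rewrite divr_ge0 ?exprn_ge0 ?powR_ge0. Qed.

Let chi_ge0 n : 0 <= chi n.
Proof. by rewrite invr_ge0 mulr_ge0 ?exprn_ge0 ?powR_ge0. Qed.

Let maj_ge0 n s : (0 <= maj n s)%E.
Proof. by rewrite lee_fin addr_ge0// mulr_ge0 ?clo_ge0 ?chi_ge0// ler0n. Qed.

Let measurable_maj n (D : set R) : measurable D -> measurable_fun D (maj n).
Proof.
move=> mD; apply/measurable_EFinP; apply: measurable_funD.
  by apply: measurable_funM; [exact: measurable_cst|apply: measurable_indic; exact: measurable_itv].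
by apply: measurable_funM; [exact: measurable_cst|apply: measurable_indic; exact: measurable_itv].
Qed.

(** For [s >= 1] the sine is bounded by 1; for [s < 1] the bound [sin (s / 2) ^+ 2 <= s ^+ 2] leaves
    [s / s^(2H)]. The index is that of the dyadic block of [s] or of its inverse. *)
Let g_le_maj s : 0 < s -> exists n, ((g s)%:E <= maj n s)%E.
Proof.
case/andP: H01 => H0 H1 s0.
have gE : g s = sin (s / 2) ^+ 2 / (s `^ (2 * H) * s).
  by rewrite /g powRD ?(gt_eqF s0) ?implybT// powRr1// ltW.
have p0 : 0 < s `^ (2 * H) by rewrite powR_gt0.
have [s1|s1] := leP 1 s.
  have [n /andP[n1 n2]] := exists_pow2_itv s1; exists n.
  rewrite lee_fin; apply: (@le_trans _ _ (chi n * \1_(hi n) s)); last first.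
    by rewrite lerDr mulr_ge0.
  rewrite indicE mem_set ?mulr1; last by rewrite /hi /= in_itv/= s0 ltW.
  rewrite gE /chi -[leRHS]mul1r.
  have e : Q ^+ n * 2 ^+ n <= s `^ (2 * H) * s.
    have Qn : 0 <= Q ^+ n by rewrite exprn_ge0// powR_ge0.
    have hq : Q ^+ n <= s `^ (2 * H).
      by rewrite -powQ ge0_ler_powR ?nnegrE ?exprn_ge0 ?(ltW s0)//; lra.
    by rewrite ler_pM// exprn_ge0.
  apply: ler_pM; rewrite ?sqr_ge0 ?invr_ge0 ?mulr_ge0 ?(ltW p0) ?(ltW s0)//.
  by rewrite lef_pV2 ?posrE ?mulr_gt0 ?exprn_gt0//; case/andP: Q_bounds => ? ?; lra.
have [|n /andP[n1 n2]] := @exists_pow2_itv s^-1; first by rewrite invf_ge1// ltW.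
exists n; rewrite lee_fin; apply: (@le_trans _ _ (clo n * \1_(lo n) s)); last first.
  by rewrite lerDl mulr_ge0.
have sn : s <= (2 ^+ n)^-1 by rewrite -[s]invrK lef_pV2 ?posrE ?invr_gt0 ?exprn_gt0.
have ns : (2 ^+ n.+1)^-1 <= s.
  by rewrite -[leRHS]invrK lef_pV2 ?posrE ?invr_gt0 ?exprn_gt0// ltW.
rewrite indicE mem_set ?mulr1; last by rewrite /lo /= in_itv/= s0.
have h1 : sin (s / 2) ^+ 2 <= s * s.
  apply: (le_trans (@sqr_sin_le (s / 2) _)); first by rewrite divr_ge0// ltW.
  by rewrite expr_div_n -expr2; have := sqr_ge0 s; lra.
apply: (@le_trans _ _ (s / s `^ (2 * H))).
  rewrite gE invfM mulrCA ler_pdivrMl//.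
  have -> : s `^ (2 * H) * (s / s `^ (2 * H)) = s by field; rewrite gt_eqF.
  by rewrite ler_pdivrMr.
have h2 : (s `^ (2 * H))^-1 <= Q ^+ n.+1.
  rewrite -[leRHS]invrK lef_pV2 ?posrE ?invr_gt0 ?exprn_gt0 ?powR_gt0//.
  rewrite -powQ -powRV ?exprn_gt0// ge0_ler_powR ?nnegrE ?invr_ge0 ?exprn_ge0//; lra.
rewrite /clo [leRHS]mulrC; apply: ler_pM => //; first exact: ltW.
by rewrite invr_ge0 ltW.
Qed.

Let integral_maj n :
  (\int[leb]_(s in `]0%R, +oo[) maj n s <= ((2 + Q) * (Num.max (Q / 4) Q^-1) ^+ n)%:E)%E.
Proof.
have /andP[Q1 Q4] := Q_bounds.
have Q0 : 0 < Q by lra.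
have mI (A : set R) (c : R) : measurable A ->
    measurable_fun (`]0%R, +oo[%classic : set R) (fun s : R => (c * \1_A s)%:E).
  move=> mA; apply/measurable_EFinP.
  by apply: measurable_funM; [exact: measurable_cst|apply: measurable_indic].
have I (c u : R) : 0 <= c -> 0 < u ->
    (\int[leb]_(s in `]0%R, +oo[) (c * \1_(`]0%R, u]%classic) s)%:E = (c * u)%:E)%E.
  move=> c0 u0; under eq_integral do rewrite EFinM.
  rewrite ge0_integralZl//=; last by apply/measurable_EFinP; exact: measurable_indic.
  rewrite integral_indic//= (_ : _ `&` _ = `]0, u]%classic); last first.
    by apply/seteqP; split => s /=; rewrite !in_itv/= ?andbT; [case|move=> /andP[-> ->]].
  by rewrite lebesgue_measure_itv/= lte_fin u0 sube0.
rewrite /maj; under eq_integral do rewrite EFinD.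
rewrite ge0_integralD//=; last 4 first.
- by move=> s _; rewrite lee_fin mulr_ge0// ?clo_ge0// indicE.
- by apply: mI; exact: measurable_itv.
- by move=> s _; rewrite lee_fin mulr_ge0// ?chi_ge0// indicE.
- by apply: mI; exact: measurable_itv.
rewrite !I ?invr_gt0 ?exprn_gt0// -EFinD lee_fin /clo /chi.
set q := Num.max _ _.
have -> : Q ^+ n.+1 / 2 ^+ n / 2 ^+ n + (Q ^+ n * 2 ^+ n)^-1 * 2 ^+ n.+1
    = Q * (Q / 4) ^+ n + 2 * Q^-1 ^+ n.
  have -> : (Q / 4) ^+ n = Q ^+ n / (2 ^+ n * 2 ^+ n).
    by rewrite expr_div_n -exprMn; congr (_ / _ ^+ n); lra.
  by rewrite !exprS exprVn; field; rewrite !gt_eqF ?exprn_gt0.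
have q4 : Q / 4 <= q by rewrite le_max lexx.
have qV : Q^-1 <= q by rewrite le_max lexx orbT.
have Q40 : 0 <= Q / 4 by rewrite divr_ge0// ltW.
have QV0 : 0 <= Q^-1 by rewrite invr_ge0 ltW.
have h1 : (Q / 4) ^+ n <= q ^+ n by rewrite lerXn2r ?nnegrE// (le_trans Q40).
have h2 : Q^-1 ^+ n <= q ^+ n by rewrite lerXn2r ?nnegrE// (le_trans Q40).
by rewrite [leRHS]mulrDl [leRHS]addrC lerD// ler_pM2l.
Qed.

(** [c_fbm] is defined through [fine], which sends an infinite integral to 0; its positivity
    therefore requires finiteness. *)
Lemma fbm_integral_lty : (\int[leb]_(s in `]0%R, +oo[) (g s)%:E < +oo)%E.
Proof.
apply: (@le_lt_trans _ _ (\int[leb]_(s in `]0%R, +oo[) \sum_(n <oo) maj n s)%E).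
  apply: ge0_le_integral => //=.
  - by move=> s _; rewrite lee_fin.
  - by apply/measurable_EFinP; apply: measurable_g.
  - by apply: ge0_emeasurable_sum => // n _; apply: measurable_maj.
  - move=> s; rewrite /= in_itv/= andbT => s0.
    have [n hn] := g_le_maj s0; apply: (le_trans hn).
    apply: le_trans (nneseries_lim_ge n.+1 _); last by move=> k _ _; exact: maj_ge0.
    by rewrite big_nat_recr//= leeDr// sume_ge0.
rewrite integral_nneseries//; last by move=> n; apply: measurable_maj.
have /andP[Q1 Q4] := Q_bounds.
pose q := Num.max (Q / 4) Q^-1.
have q01 : 0 <= q < 1.
  rewrite le_max invr_ge0 gt_max invf_lt1; lra.
apply: (@le_lt_trans _ _ (((2 + Q) / (1 - q))%:E)); last exact: ltry.
apply: lime_le; first by apply: is_cvg_nneseries => n _ _; exact: integral_ge0.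
apply: nearW => n; apply: le_trans (_ : \sum_(0 <= i < n) ((2 + Q) * q ^+ i)%:E <= _)%E.
  by apply: lee_sum => i _; exact: integral_maj.
by rewrite sumEFin lee_fin sum_geometric_le//; lra.
Qed.

Lemma c_fbm_gt0 : 0 < c_fbm H.
Proof.
rewrite /c_fbm mulr_gt0 ?divr_gt0 ?pi_gt0// /Rintegral -/g fine_gt0// fbm_integral_lty andbT.
have s12 : 0 < sin (2^-1 : R) by apply: sin2_gt0; apply/andP; split; lra.
(* Lower bound of the integrand on [[1, 2]]: there [s / 2] stays between 1/2 and 1, where the sine
   increases, and [s^(2H+1) <= 2^3]. *)
pose m : R := sin 2^-1 ^+ 2 / 8.
have m0 : 0 < m by rewrite divr_gt0 ?exprn_gt0.
apply: (@lt_le_trans _ _ (\int[leb]_(s in `[1%R, 2%R]) m%:E)%E).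
  rewrite integral_cst//= lebesgue_measure_itv/= lte_fin ltr1n.
  by rewrite -EFinB -EFinM lte_fin mulr_gt0//; lra.
apply: (@le_trans _ _ (\int[leb]_(s in `[1%R, 2%R]) (g s)%:E)%E).
  apply: ge0_le_integral => //=.
  - by move=> s _; rewrite lee_fin ltW.
  - by apply/measurable_EFinP; exact: measurable_g.
  move=> s; rewrite /= in_itv/= => /andP[s1 s2]; rewrite lee_fin /m /g.
  have pi2 := pi_ge2 R.
  have sin_le : sin 2^-1 <= sin (s / 2).
    rewrite leNgt ltr_sin ?in_itv/=; last 2 first.
    - by apply/andP; split; lra.
    - by apply/andP; split; lra.
    by rewrite -leNgt; lra.
  apply: ler_pM; rewrite ?sqr_ge0 ?invr_ge0//.
    by rewrite lerXn2r ?nnegrE ?(ltW s12)// (le_trans (ltW s12)).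
  rewrite lef_pV2 ?posrE ?powR_gt0//; last lra.
  rewrite (_ : 8 = 2 `^ 3%:R); last by rewrite powR_mulrn//; lra.
  apply: (@le_trans _ _ (2 `^ (2 * H + 1))).
    by case/andP: H01 => ? ?; rewrite ge0_ler_powR ?nnegrE//; lra.
  by case/andP: H01 => ? ?; rewrite ler_powR//; lra.
apply: ge0_subset_integral => //=.
- by apply/measurable_EFinP; exact: measurable_g.
- by move=> s _; rewrite lee_fin.
- by move=> s /=; rewrite !in_itv/= andbT => /andP[? _]; lra.
Qed.

End FbmConstant.

(** * Comparison of the weighted modulus with the unweighted one *)

Section RegularVariationBounds.
Variables (R : realType) (H : R) (theta L eps : R -> R) (c1 x0 : R).
Hypothesis theta_rv : normalized_regvar H theta L eps c1 x0.

Lemma regvar_gt0 (x : R) : 0 < x -> 0 < L x.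
Proof.
move=> x_gt0; have [[c1_gt0 x0_gt0] _ _ [Llo Lhi] _] := theta_rv.
have [xx0|x0x] := ltP x x0; first by rewrite Llo// x_gt0.
by rewrite Lhi// mulr_gt0// expR_gt0.
Qed.

Hypothesis H_gt0 : 0 < H.
Hypothesis L_limsup :
  (limf_esup (fun x : R => (L x)%:E) (pinfty_nbhs R) < +oo)%E.

(** The upper limit controls large arguments. On the remaining segment the smoothness assumption
    concerns [theta], which is continuous there and dominates [L] because [x^(2H+1) >= 1]. *)
Lemma regvar_bounded : exists2 M : R, 0 < M & forall x, 1 <= x -> L x <= M.
Proof.
have [_ dth thE _ _] := theta_rv.
have [M1 [M2 hM]] : exists M1 M2 : R, forall x, M1 < x -> L x <= M2.
  move: L_limsup; rewrite limf_esupE => /ereal_inf_lt[_ [V [M1 [_ MV]] <-]] supV.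
  exists M1, (fine (ereal_sup ((fun x => (L x)%:E) @` V))) => x /MV Vx.
  have h : ((L x)%:E <= ereal_sup ((fun x => (L x)%:E) @` V))%E.
    by apply: ereal_sup_ubound; exists x.
  rewrite -lee_fin fineK//; rewrite fin_numE -ltey supV andbT.
  by apply/eqP => e; move: h; rewrite e.
pose T := Num.max 2 (M1 + 1).
have T1 : 1 <= T by rewrite le_max; apply/orP; left; lra.
have cth : {within `[1, T], continuous theta}.
  apply: derivable_within_continuous => x; rewrite in_itv/= => /andP[x1 _].
  by apply: (dth 0%N); lra.
have [c _ hc] := EVT_max T1 cth.
exists (Num.max 1 (Num.max M2 (theta c))); first by rewrite lt_max ltr01.
move=> x x1; rewrite !le_max; apply/orP; right; apply/orP.
have [xT|Tx] := leP x T; [right|left].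
  have xc : theta x <= theta c by apply: hc; rewrite in_itv/= x1.
  apply: le_trans xc; rewrite thE; last lra.
  have Lx : 0 < L x by apply: regvar_gt0; lra.
  rewrite ler_peMl ?(ltW Lx)//.
  by rewrite -[leLHS](powRr0 x) ler_powR// addr_ge0// mulr_ge0// ltW.
by apply: hM; apply: lt_trans Tx; rewrite lt_max; apply/orP; right; lra.
Qed.

Hypothesis H_lt1 : H < 1.

(** A drift of modulus [x^H log^(1/2) (1/x)] is thereby in the space of the weighted modulus. For
    [x <= 1] only values of [L] on [[1, +oo[] occur. *)
Lemma w_ell_ge : exists2 c : R, 0 < c & forall x, 0 < x <= 1 ->
  c * (x `^ H * Num.sqrt (ln x^-1)) <= w_ell H L x.
Proof.
have [M M0 hM] := regvar_bounded.
have cH : 0 < c_fbm H by apply: c_fbm_gt0; rewrite H_gt0.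
exists (Num.sqrt (c_fbm H) * (Num.sqrt M)^-1).
  by rewrite mulr_gt0 ?invr_gt0 ?sqrtr_gt0.
move=> x /andP[x_gt0 x1]; rewrite /w_ell gt_eqF// /ell.
have xV : 1 <= x^-1 by rewrite invf_ge1.
have Lx : 0 < L x^-1 by rewrite regvar_gt0 ?invr_gt0.
rewrite mulrCA mulrA ler_wpM2r ?sqrtr_ge0// ler_wpM2l ?powR_ge0//.
rewrite ler_wpM2l ?sqrtr_ge0// lef_pV2 ?posrE ?sqrtr_gt0//.
by rewrite ler_wsqrtr// hM.
Qed.

End RegularVariationBounds.

(** This is [ln y <= y] at [y = x^(-H)]. The right-hand side tends to 0 with [x], which gives
    continuity of the drift. *)
Lemma powR_sqrt_ln_le (R : realType) (H x : R) : 0 < H -> 0 < x ->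
  x `^ H * Num.sqrt (ln x^-1) <= Num.sqrt (x `^ H / H).
Proof.
move=> H0 x0; have p0 : 0 < x `^ H by rewrite powR_gt0.
rewrite -{1}(ger0_norm (ltW p0)) -sqrtr_sqr -sqrtrM ?sqr_ge0// ler_wsqrtr//.
rewrite expr2 -mulrA ler_pM2l// lnV ?posrE//.
have h : ln (x `^ H)^-1 <= (x `^ H)^-1 by rewrite ltW// ln_sublinear// invr_gt0.
move: h; rewrite lnV ?posrE// ln_powR => h.
rewrite -[leRHS]mul1r ler_pdivlMr//.
have -> : x `^ H * - ln x * H = x `^ H * - (H * ln x) by ring.
by rewrite -(mulfV (lt0r_neq0 p0)) ler_pM2l.
Qed.

(** * Capacity and Hausdorff measure of sets with small covers *)

Section Capacity.
Variable R : realType.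
Local Open Scope ereal_scope.

(* No measurability of [f] is needed: the integral is a supremum over the
   simple functions below [f]. *)
Lemma le_integral_cst d (T : measurableType d)
    (mu : {measure set T -> \bar R}) (f : T -> \bar R) (A : set T) (c : R) :
  (forall x, 0 <= f x) -> measurable A -> (0 <= c)%R ->
  (forall x, A x -> c%:E <= f x) -> c%:E * mu A <= \int[mu]_x f x.
Proof.
move=> f0 mA c0 fA; rewrite ge0_integralTE//.
rewrite -(sintegral_indic mu A) -(sintegralrM mu c (indic_nnsfun R mA)).
apply: ereal_sup_ubound; exists (scale_nnsfun (indic_nnsfun R mA) c0) => //=.
move=> x; rewrite mindicE; have [|_] := boolP (x \in A).
  by rewrite inE mulr1 => /fA.
by rewrite mulr0.
Qed.

(* Cells of mass below [1 / (2 N)] carry at most half of the mass. *)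
Lemma energy_ge (T : ptopologicalType) (rho : T -> T -> R) (beta : R)
    (G : set T) (mu : probability (g_sigma_algebraType (@open T)) R)
    (N : nat) (A : nat -> set T) (e : R) :
  mu.-negligible (~` G) -> (0 < N)%N -> (0 < e)%R ->
  (forall i, closed (A i)) -> G `<=` \bigcup_(i in `I_N) A i ->
  (forall i u v, A i u -> A i v -> rho u v `^ beta <= e)%R ->
  ((4 * N%:R * e)^-1)%:E <= energy rho beta mu.
Proof.
move=> [Z [mZ Z0 GZ]] N0 e0 cA GA rhoA.
pose S := g_sigma_algebraType (@open T).
pose B : nat -> set S := A.
have mB i : measurable (B i).
  have -> : B i = ~` (~` (A i)) by rewrite setCK.
  by apply: measurableC; apply: sub_gen_smallest; exact: closed_openC.
have NR : (0 < N%:R :> R)%R by rewrite ltr0n.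
pose t : R := ((2 * N%:R)^-1)%R.
have t0 : (0 < t)%R by rewrite invr_gt0 mulr_gt0.
pose good i := t%:E <= mu (B i).
pose C i := if good i then B i else set0.
pose D i := if good i then set0 else B i.
have mC i : measurable (C i) by rewrite /C; case: ifP.
have mD i : measurable (D i) by rewrite /D; case: ifP.
pose U := \big[setU/set0]_(i < N) C i.
pose V := \big[setU/set0]_(i < N) D i.
have mU : measurable U by exact: bigsetU_measurable.
have mV : measurable V by exact: bigsetU_measurable.
have UV : (setT : set S) `<=` (U `|` V) `|` Z.
  move=> x _; have [Gx|nGx] := pselect (G x); last by right; apply: GZ.
  left; have [i /= iN Ax] := GA _ Gx.
  rewrite /U /V -!bigcup_mkord.
  have [gi|gi] := boolP (good i).
    by left; exists i => //; rewrite /C gi.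
  by right; exists i => //; rewrite /D (negbTE gi).
have V2 : mu V <= (2^-1)%:E.
  apply: (le_trans (Boole_inequality mu (fun i _ => mD i))).

  apply: (@le_trans _ _ (\sum_(i < N) t%:E)).
    apply: lee_sum => i _; rewrite /D; case: ifPn => [_|/negP].
      by rewrite measure0 lee_fin ltW.
    by rewrite /good => /negP; rewrite -ltNge => /ltW.
  rewrite sumEFin lee_fin sumr_const card_ord -[leLHS]mulr_natr /t invfM.
  by rewrite -mulrA mulVf ?mulr1 ?gt_eqF.
have U2 : (2^-1)%:E <= mu U.
  have : 1 <= mu U + mu V + mu Z.
    rewrite -(@probability_setT _ _ _ mu).
    apply: (le_trans (le_measure _ _ _ UV)); rewrite ?inE//.
      by apply: measurableU => //; exact: measurableU.
    have mUV : measurable (U `|` V) by exact: measurableU.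
    apply: (@le_trans _ _ (mu (U `|` V) + mu Z)); first exact: measureU2.
    by rewrite leeD2r//; exact: measureU2.
  rewrite Z0 adde0 => h; have {h} := le_trans h (leeD (lexx (mu U)) V2).
  rewrite -leeBlDr// -EFinB => /(le_trans _); apply.
  by rewrite lee_fin; lra.
have K0 u v : 0 <= ((rho u v `^ beta)%:E)^-1 by rewrite inve_ge0 lee_fin powR_ge0.
apply: (@le_trans _ _ ((e^-1 * t)%:E * mu U)).
  rewrite -[leLHS](_ : (e^-1 * t)%:E * (2^-1)%:E = _).
    by rewrite lee_pmul2l// lte_fin mulr_gt0// invr_gt0.
  rewrite -EFinM /t; congr (_%:E); field.
  by rewrite !gt_eqF.
apply: le_integral_cst => //; first by move=> u; apply: integral_ge0.
  by rewrite ltW// mulr_gt0// invr_gt0.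
move=> u; rewrite /U -bigcup_mkord => -[i /= iN]; rewrite /C.
have [gi Au|//] := boolP (good i).
(* For [u] in a cell of mass at least [t], the inner integral restricted to that cell is already at
   least [t / e]; the points where the distance power vanishes have an infinite kernel. *)
apply: (@le_trans _ _ ((e^-1)%:E * mu (B i))).
  by rewrite EFinM lee_pmul2l// lte_fin invr_gt0.
apply: le_integral_cst => //; first by rewrite invr_ge0 ltW.
move=> v Av; have := rhoA i u v Au Av; have := powR_ge0 (rho u v) beta.
rewrite inver; case: eqP => [_ _ _|/eqP x0 xge xle]; first by rewrite leey.
by rewrite lee_fin lef_pV2 ?posrE// lt_neqAle eq_sym x0.
Qed.

(** Every admissible measure has energy at least [(4 * N * e)^-1] for each cover, so small products
    [N * e] make all energies infinite. *)
Lemma capacity_eq0 (T : ptopologicalType) (rho : T -> T -> R) (beta : R)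
    (G : set T) :
  (forall eps : R, (0 < eps)%R -> exists (N : nat) (A : nat -> set T) (e : R),
    [/\ (0 < N)%N /\ (0 < e)%R, (forall i, closed (A i)),
      G `<=` \bigcup_(i in `I_N) A i,
      (forall i u v, A i u -> A i v -> rho u v `^ beta <= e)%R
      & (N%:R * e <= eps)%R]) ->
  capacity rho beta G = 0.
Proof.
move=> H; rewrite /capacity (_ : ereal_inf _ = +oo) ?invey//.
apply/eqP; rewrite -leye_eq; apply: le_ereal_inf_tmp => _ [mu muG <-].
rewrite leye_eq; apply/eqP; apply/eqyP => M M0.
have [|N [A [e [[N0 e0] cA GA rhoA h]]]] := H (4 * M)^-1%R.
  by rewrite invr_gt0 mulr_gt0.
apply: le_trans (energy_ge muG N0 e0 cA GA rhoA).
rewrite lee_fin -[leLHS]invrK lef_pV2 ?posrE ?invr_gt0 ?mulr_gt0 ?ltr0n//.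
by move: h; rewrite invfM -mulrA ler_pdivlMl.
Qed.

End Capacity.

Section HausdorffNull.
Variable R : realType.
Local Open Scope ereal_scope.

Lemma hausdorff_measure_eq0 (T : Type) (X : set T) (rho : T -> T -> R)
    (beta : R) (G : set T) : beta != 0%R ->
  (forall del eps : R, (0 < del)%R -> (0 < eps)%R ->
    exists (N : nat) (c : nat -> T) (r : R),
    [/\ (0 <= r <= del)%R, forall n, X (c n),
      G `<=` \bigcup_(n in `I_N) [set u | X u /\ (rho (c n) u < r)%R]
      & (N%:R * (2 * r) `^ beta <= eps)%R]) ->
  hausdorff_measure X rho beta G = 0.
Proof.
move=> b0 H.
have content0 del : (0 < del)%R -> hausdorff_content X rho beta G del = 0.
  move=> del0; apply/eqP; rewrite eq_le; apply/andP; split; last first.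
    apply: le_ereal_inf_tmp => _ [c [r [_ _ _ ->]]].
    by apply: nneseries_ge0 => n _ _; rewrite lee_fin powR_ge0.
  apply/lee_addgt0Pr => eps eps0; rewrite add0e.
  have [N [c [r [/andP[r0 rdel] Xc Gc h]]]] := H _ _ del0 eps0.
  (* Beyond [N] the balls have radius 0: they are empty and, as [beta != 0], cost nothing. *)
  pose r' n := if (n < N)%N then r else 0%R.
  apply: (@le_trans _ _ (\sum_(0 <= n <oo) ((2 * r' n) `^ beta)%:E)).
    apply: ereal_inf_lbound; exists c, r'; split => //.
      by move=> n; rewrite /r'; case: ifP => _; rewrite ?r0 ?rdel ?lexx ?ltW.
    move=> u /Gc [n /= nN [Xu ru]]; exists n => //; split => //.
    by rewrite /r' nN.
  apply: lime_le; first by apply: is_cvg_nneseries => n _ _; rewrite lee_fin powR_ge0.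
  apply: nearW => n; rewrite sumEFin lee_fin (le_trans _ h)//.
  apply: (@le_trans _ _ (\sum_(0 <= i < N) (2 * r) `^ beta)%R); last first.
    by rewrite sumr_const_nat subn0 [leRHS]mulr_natl.
  have pw i : ((2 * r' i) `^ beta = if (i < N)%N then (2 * r) `^ beta else 0)%R.
    by rewrite /r'; case: ifP => // _; rewrite mulr0 powR0.
  under eq_bigr do rewrite pw.
  apply: (@le_trans _ _ (\sum_(0 <= i < maxn n N) if (i < N)%N then (2 * r) `^ beta else 0)%R).
    rewrite [leRHS](big_cat_nat (leq0n n) (leq_maxl n N))//= lerDl sumr_ge0// => i _.
    by case: ifP => // _; exact: powR_ge0.
  rewrite (big_cat_nat (leq0n N) (leq_maxr n N))//= [X in (_ + X)%R]big_nat_cond.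
  rewrite [X in (_ + X)%R]big1 ?addr0; last first.
    by move=> i /andP[/andP[Ni _] _]; rewrite ltnNge Ni.
  by rewrite big_nat [leRHS]big_nat; apply: ler_sum => i /andP[_ ->].
apply: cvg_lim => //.
by apply: cvg_near_cst; near=> del; apply: content0; near: del; exact: nbhs_right_gt.
Unshelve. all: by end_near. Qed.

End HausdorffNull.

(** * The scales of the construction *)

Section LevelParameters.
Variable R : realType.
Implicit Types (h c x D : R).

Lemma near_powR_le h c : 0 < h -> 0 < c -> \forall D \near 0^'+, D `^ h <= c.
Proof.
move=> h0 c0; near=> D; apply: ltW; near: D.
by have /cvgr_lt := powR_cvg0 h0; apply.
Unshelve. all: by end_near. Qed.

Lemma near_ln_le c : \forall D \near (0 : R)^'+, ln D <= c.
Proof. by have /cvgrNyPle := @lnNy R; apply. Qed.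

(** Two regimes. If [D <= x ^+ 2], half of the power [D^H] is absorbed by [x^H] and the other half
    beats the constants, the logarithm being bounded below since [x <= xi < 1]. If [x ^+ 2 < D], the
    minimum is at most [N * Q * x^H], and [ln x^-1] exceeds half of [ln D^-1], which is as large as
    desired. *)
Lemma near_wave_modulus (H xi N Q c : R) : 0 < H < 1 -> 0 < xi < 1 ->
  1 <= N -> 1 <= Q -> 0 < c -> \forall D \near 0^'+,
  forall x, 0 < x <= xi ->
    Num.min (N * D `^ H) (N * D `^ H * Q / D * x)
      <= c * (x `^ H * Num.sqrt (ln x^-1)).
Proof.
move=> /andP[H0 H1] /andP[xi0 xi1] N1 Q1 c0.
have lxi : 0 < Num.sqrt (ln xi^-1) by rewrite sqrtr_gt0 ln_gt0// invf_gt1.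
have N0 : 0 < N by lra.
have Q0 : 0 < Q by lra.
near=> D.
have D0 : 0 < D by near: D; exact: nbhs_right_gt.
move=> x /andP[x0 xxi].
have [Dx|xD] := leP D (x ^+ 2).
  rewrite ge_min; apply/orP; left.
  have e : D `^ H = D `^ (H / 2) * D `^ (H / 2).
    by rewrite -powRD ?gt_eqF ?implybT// -splitr.
  have h1 : D `^ (H / 2) <= x `^ H.
    have -> : x `^ H = (x ^+ 2) `^ (H / 2).
      by rewrite [H / 2]mulrC powRrM powR12_sqrt ?sqr_ge0// sqrtr_sqr ger0_norm ?ltW.
    by rewrite ge0_ler_powR ?nnegrE ?sqr_ge0//; lra.
  have h2 : D `^ (H / 2) <= c * Num.sqrt (ln xi^-1) / N.
    near: D; apply: near_powR_le; first by rewrite divr_gt0.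
    by rewrite divr_gt0// mulr_gt0.
  have h3 : Num.sqrt (ln xi^-1) <= Num.sqrt (ln x^-1).
    rewrite ler_wsqrtr// ler_ln ?posrE ?invr_gt0// lef_pV2 ?posrE//.
  apply: (@le_trans _ _ (N * ((c * Num.sqrt (ln xi^-1) / N) * x `^ H))).
    by rewrite e ler_pM2l// ler_pM ?powR_ge0.
  rewrite mulrA [N * _]mulrC divfK ?gt_eqF// -mulrA ler_pM2l// mulrC.
  by rewrite ler_wpM2l ?powR_ge0.
apply: (@le_trans _ _ (N * Q * x `^ H)).
  rewrite ge_min; have [Dx|{}xD'] := leP D x; apply/orP; [left|right].
    apply: (@le_trans _ _ (N * x `^ H)); last first.
      by rewrite ler_wpM2r ?powR_ge0// ler_peMr// ltW.
    by rewrite ler_pM2l// ge0_ler_powR ?nnegrE// ltW.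
  have -> : N * D `^ H * Q / D * x = N * Q * (D `^ H * (x / D)) by field; rewrite gt_eqF.
  rewrite ler_pM2l ?mulr_gt0//.
  apply: (@le_trans _ _ (D `^ H * (x / D) `^ H)).
    rewrite ler_wpM2l ?powR_ge0// ger1_powR ?(ltW H1)// divr_gt0//=.
    by rewrite ler_pdivrMr// mul1r ltW.
  rewrite -powRM; [|exact: ltW|by rewrite ltW// divr_gt0].
  by rewrite [D * _]mulrC divfK ?gt_eqF.
have -> : c * (x `^ H * Num.sqrt (ln x^-1)) = c * Num.sqrt (ln x^-1) * x `^ H by ring.
rewrite ler_wpM2r ?powR_ge0// -ler_pdivrMl//.
set M := _^-1 * _.
have M0 : 0 <= M by rewrite mulr_ge0 ?invr_ge0 ?mulr_ge0 ?ltW.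
rewrite -[leLHS]ger0_norm// -sqrtr_sqr ler_wsqrtr//.
rewrite lnV ?posrE//.
have hD : ln D <= - (2 * M ^+ 2) by near: D; exact: near_ln_le.
have : ln (x ^+ 2) <= ln D by rewrite ler_ln ?posrE ?exprn_gt0// ltW.
by rewrite lnXn// => h; move: h; rewrite -mulr_natl; lra.
Unshelve. all: by end_near. Qed.

Lemma expR_poly_le (d : nat) x : 0 < x -> expR (- x) <= d.+1%:R ^+ d.+1 / x ^+ d.+1.
Proof.
move=> x0; rewrite expRN -expr_div_n -[leRHS]invrK lef_pV2 ?posrE ?expR_gt0//; last first.
  by rewrite invr_gt0 exprn_gt0// divr_gt0.
rewrite -exprVn invf_div.
have -> : expR x = expR (x / d.+1%:R) ^+ d.+1 by rewrite -expRM_natr divfK ?pnatr_eq0.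
rewrite lerXn2r ?nnegrE ?expR_ge0 ?divr_ge0 ?(ltW x0)//.
have h : 1 + x / d.+1%:R <= expR (x / d.+1%:R) by exact: expR_ge1Dx.
by apply: le_trans h; rewrite lerDr.
Qed.

(** [N] is linear in [mu], so [N ^+ d] costs [mu ^+ d]; bounding the exponential by the power [d.+1]
    of [mu^-1] leaves a spare factor [mu^-1]. Taking [mu >= 4] replaces [mu ^+ 2 / 4] by [mu]. *)
Lemma exists_tail_size (d : nat) (A c eps : R) : 0 <= A -> 0 <= c -> 0 < eps ->
  exists (mu : R) (N : nat), [/\ 1 <= mu, (1 < N)%N, A * mu <= N%:R &
    c * N%:R ^+ d * expR (- mu ^+ 2 / 4) <= eps].
Proof.
move=> A0 c0 eps0.
pose K := c * (A + 2) ^+ d * d.+1%:R ^+ d.+1 / eps.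
have K0 : 0 <= K by rewrite /K divr_ge0 ?mulr_ge0 ?exprn_ge0 ?ler0n ?(ltW eps0)//; lra.
pose mu := K + 4; have mu4 : 4 <= mu by rewrite /mu; lra.
have mu0 : 0 < mu by lra.
have Am : 0 <= A * mu by rewrite mulr_ge0// ltW.
exists mu, (Num.truncn (A * mu)).+2; split => //; first lra.
  by have /andP[_ /ltW h] := truncn_itv Am; rewrite (le_trans h)// ler_nat.
have hN : (Num.truncn (A * mu)).+2%:R <= (A + 2) * mu.
  have /andP[h _] := truncn_itv Am; rewrite -addn2 natrD; lra.
apply: (@le_trans _ _ (c * ((A + 2) * mu) ^+ d * (d.+1%:R ^+ d.+1 / mu ^+ d.+1))).
  apply: ler_pM; rewrite ?mulr_ge0 ?exprn_ge0 ?expR_ge0 ?ler0n//.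
    by rewrite ler_wpM2l// lerXn2r ?nnegrE ?ler0n// mulr_ge0//; lra.
  apply: le_trans (expR_poly_le d mu0).
  by rewrite ler_expR mulNr lerN2 ler_pdivlMr// expr2 ler_pM2l.
rewrite exprMn [mu ^+ d.+1]exprS.
have -> : c * ((A + 2) ^+ d * mu ^+ d) * (d.+1%:R ^+ d.+1 / (mu * mu ^+ d)) = K * eps / mu.
  by rewrite /K; field; rewrite !gt_eqF// exprn_gt0.
by rewrite ler_pdivrMr// mulrC ler_pM2l// /mu; lra.
Qed.

End LevelParameters.

Section Levels.
Variable R : realType.

(* [D] is the period of the wave of the scale, [N] its number of grid values
   along each axis, [mu] bounds the normalized increments of the process, and
   [Lip] is a Lipschitz constant of the sum of the waves constructed so far. *)
Record level := Level { lvD : R; lvN : nat; lvmu : R; lvLip : R }.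

Variables (d : nat) (H xi K : R).
Implicit Types l : level.

(* The natural size of the process at the scale, the amplitude of the wave, the
   number of grid points, the mesh of the time lattice, and a bound for the
   number of its points in [0, 1]. *)
Definition lvr l := lvD l `^ H.
Definition lvs l := (lvN l)%:R * lvr l.
Definition lvQ l : R := (lvN l)%:R ^+ d.
Definition lvsig l := lvD l / lvQ l.
Definition lvcnt l := (lvsig l)^-1 + 2.

(* [next_tail] makes the union bound over the increments of the scale work,
   [next_gain] makes the covers of the scale small, and [next_modulus] bounds
   the contribution of the scale to the modulus of the drift: the first two
   determine [mu] and [N], and the other ones hold for [D] small enough. *)
Record next_level (n : nat) (l l' : level) : Prop := NextLevel {
  next_D_gt0 : 0 < lvD l';
  next_N_gt1 : (1 < lvN l')%N;
  next_mu_ge1 : 1 <= lvmu l';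
  next_LipE : lvLip l' = lvLip l + lvs l' * lvQ l' / lvD l';
  next_D_le : lvD l' <= lvD l / 16;
  next_s_le : lvs l' <= lvr l / 16;
  next_Lip_le : 6 * lvLip l * lvD l' <= lvr l';
  next_tail : d%:R * lvcnt l * (5 * lvQ l') * (2 * expR (- lvmu l' ^+ 2 / 4))
                <= 2^-1 ^+ n / 8;
  next_gain : 2 ^+ n * lvcnt l * K * lvmu l' <= (lvN l')%:R;
  next_modulus : forall x, 0 < x <= xi ->
    Num.min (lvs l') (lvs l' * lvQ l' / lvD l' * x)
      <= 2^-1 ^+ n * (x `^ H * Num.sqrt (ln x^-1)) }.

Hypotheses (H01 : 0 < H < 1) (xi01 : 0 < xi < 1) (K_ge0 : 0 <= K).

Lemma next_level_exists n l : 0 < lvD l -> (0 < lvN l)%N -> 0 <= lvLip l ->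
  exists l', next_level n l l'.
Proof.
case/andP: H01 => H0 H1 D0 N0 Lip0.
have cnt0 : 0 <= lvcnt l.
  by rewrite addr_ge0// invr_ge0 divr_ge0 ?(ltW D0)// exprn_ge0// ler0n.
have [|||mu [N [mu1 N1 gain tail]]] := @exists_tail_size R d (2 ^+ n * lvcnt l * K)
    (d%:R * lvcnt l * 10) (2^-1 ^+ n / 8).
- by rewrite !mulr_ge0// exprn_ge0.
- by rewrite !mulr_ge0// ler0n.
- by rewrite divr_gt0// exprn_gt0.
have NR : 1 <= N%:R :> R by rewrite ler1n ltnW.
have QR : 1 <= N%:R ^+ d :> R by rewrite exprn_ege1.
have c0 : 0 < 2^-1 ^+ n :> R by rewrite exprn_gt0.
have H1' : 0 < 1 - H by lra.
have r0 : 0 < lvr l by rewrite powR_gt0.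
(* The bound on the power [1 - H] of [D] yields [next_Lip_le]: as [H < 1], [D] is negligible with
   respect to [D^H]. The [+ 1] is there because [lvLip] is 0 at the initial level. *)
have [D [[D'0 h1] [h2 h3] h4]] : exists D, [/\ 0 < D /\ D <= lvD l / 16,
   D `^ H <= lvr l / 16 / N%:R /\ D `^ (1 - H) <= (6 * (lvLip l + 1))^-1
   & forall x, 0 < x <= xi -> Num.min (N%:R * D `^ H) (N%:R * D `^ H * N%:R ^+ d / D * x)
      <= 2^-1 ^+ n * (x `^ H * Num.sqrt (ln x^-1))].
  suff : \forall D \near (0 : R)^'+, [/\ 0 < D /\ D <= lvD l / 16,
   D `^ H <= lvr l / 16 / N%:R /\ D `^ (1 - H) <= (6 * (lvLip l + 1))^-1
   & forall x, 0 < x <= xi -> Num.min (N%:R * D `^ H) (N%:R * D `^ H * N%:R ^+ d / D * x)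
      <= 2^-1 ^+ n * (x `^ H * Num.sqrt (ln x^-1))] by move=> /filter_ex.
  near=> D; split; [split|split|].
  - by near: D; exact: nbhs_right_gt.
  - by near: D; apply: nbhs_right_le; rewrite divr_gt0.
  - by near: D; apply: near_powR_le => //; rewrite !divr_gt0//; lra.
  - by near: D; apply: near_powR_le => //; rewrite invr_gt0 mulr_gt0//; lra.
  - by near: D; exact: near_wave_modulus.
exists (Level D N mu (lvLip l + N%:R * D `^ H * N%:R ^+ d / D)).
split => //=.
- by rewrite /lvs /lvr /= mulrC -ler_pdivlMr//; lra.
- rewrite /lvr /=.
  have e : D `^ (1 - H) * D `^ H = D.
    rewrite -powRD; last by rewrite (gt_eqF D'0) implybT.
    by rewrite subrK powRr1// ltW.
  rewrite -[X in _ * X <= _]e mulrA ler_piMl ?powR_ge0//.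
  have L1 : 0 < 6 * (lvLip l + 1) by rewrite mulr_gt0//; lra.
  apply: (@le_trans _ _ (6 * (lvLip l + 1) * (6 * (lvLip l + 1))^-1)).
    by apply: ler_pM => //; rewrite ?powR_ge0// ?mulr_ge0//; lra.
  by rewrite mulfV// gt_eqF.
- by apply: le_trans tail; rewrite /lvQ /= le_eqVlt; apply/orP; left; apply/eqP; ring.
Unshelve. all: by end_near. Qed.

Lemma levels_exist (D0 : R) : 0 < D0 ->
  exists lv : nat -> level, lv 0%N = Level D0 1 1 0 /\
  forall n, next_level n (lv n) (lv n.+1).
Proof.
move=> D0_gt0; pose good l := [/\ 0 < lvD l, (0 < lvN l)%N & 0 <= lvLip l].
(* The successor is made total by a conditional specification, so that the sequence can be defined
   first and shown to stay in [good] afterwards. *)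
have nx (p : nat * level) : {l' | good p.2 -> next_level p.1 p.2 l'}.
  apply: cid; have [[g1 g2 g3]|ng] := pselect (good p.2); last by exists p.2.
  by have [l' hl'] := @next_level_exists p.1 p.2 g1 g2 g3; exists l'.
pose fix lv n := if n is m.+1 then sval (nx (m, lv m)) else Level D0 1 1 0.
exists lv; split => //.
have step n : good (lv n) -> next_level n (lv n) (lv n.+1).
  exact: (svalP (nx (n, lv n))).
suff glv n : good (lv n) by move=> n; exact: step.
elim: n => [|n IH]; first by split.
have [D1 N1 _ LipE _ _ _ _ _ _] := step n IH; split => //; first exact: ltnW.
rewrite LipE addr_ge0//; first by case: IH.
by rewrite divr_ge0 ?(ltW D1)// !mulr_ge0 ?ler0n ?powR_ge0 ?exprn_ge0.
Qed.

End Levels.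

(** * The drift and the targets *)

Section EuclideanNorm.
Variables (R : realType) (d : nat).
Implicit Type x : 'rV[R]_d.

Lemma enorm_le x (c : R) : 0 <= c -> (forall j, `|x ord0 j| <= c) ->
  enorm x <= d%:R * c.
Proof.
move=> c0 hx; rewrite /enorm -[leRHS]ger0_norm ?mulr_ge0// -sqrtr_sqr.
rewrite ler_wsqrtr//; apply: (@le_trans _ _ (\sum_(j < d) c ^+ 2)).
  apply: ler_sum => j _; rewrite -(real_normK (num_real (x ord0 j))).
  by rewrite lerXn2r ?nnegrE.
rewrite sumr_const card_ord -[leLHS]mulr_natl exprMn ler_wpM2r ?sqr_ge0//.
by rewrite -natrX ler_nat; case: d => // n; rewrite expnS leq_pmulr// expn_gt0.
Qed.

Lemma enorm_ge x j : `|x ord0 j| <= enorm x.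
Proof.
rewrite /enorm -sqrtr_sqr ler_wsqrtr// (bigD1 j)//= lerDl.
by apply: sumr_ge0 => i _; exact: sqr_ge0.
Qed.

End EuclideanNorm.

Section Drift.
Variables (R : realType) (d : nat) (H xi K Dz : R) (lv : nat -> level R).
Hypotheses (H01 : 0 < H < 1) (Dz_itv : 0 < Dz < 1) (K_ge : 100 <= K).
Hypotheses (lv0 : lv 0%N = Level Dz 1 1 0)
  (lvS : forall n, next_level d H xi K n (lv n) (lv n.+1)).

Local Notation D n := (lvD (lv n)).
Local Notation N n := (lvN (lv n)).
Local Notation mu n := (lvmu (lv n)).
Local Notation Lip n := (lvLip (lv n)).
Local Notation r n := (lvr H (lv n)).
Local Notation s n := (lvs H (lv n)).
Local Notation Q n := (lvQ d (lv n)).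
Local Notation sig n := (lvsig d (lv n)).

Lemma lvD_gt0 n : 0 < D n.
Proof. by case: n => [|n]; [rewrite lv0 /=; case/andP: Dz_itv|case: (lvS n)]. Qed.

Lemma lvN_gt0 n : (0 < N n)%N.
Proof. by case: n => [|n]; [rewrite lv0|exact: ltnW (next_N_gt1 (lvS n))]. Qed.

Lemma lvr_gt0 n : 0 < r n. Proof. exact/powR_gt0/lvD_gt0. Qed.

Lemma lvs_gt0 n : 0 < s n.
Proof. by rewrite mulr_gt0 ?lvr_gt0 ?ltr0n ?lvN_gt0. Qed.

Lemma lvr_le_lvs n : r n <= s n.
Proof. by rewrite ler_peMl ?(ltW (lvr_gt0 n))// ler1n lvN_gt0. Qed.

Lemma lvQ_gt0 n : 0 < Q n. Proof. by rewrite exprn_gt0// ltr0n lvN_gt0. Qed.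

Lemma lvsig_gt0 n : 0 < sig n. Proof. by rewrite divr_gt0 ?lvD_gt0 ?lvQ_gt0. Qed.

Lemma lvLip_ge0 n : 0 <= Lip n.
Proof.
elim: n => [|n IH]; first by rewrite lv0.
rewrite (next_LipE (lvS n)) addr_ge0// divr_ge0 ?(ltW (lvD_gt0 _))//.
by rewrite mulr_ge0 ?(ltW (lvs_gt0 _)) ?(ltW (lvQ_gt0 _)).
Qed.

Lemma lvD_succ_le n : D n.+1 <= D n / 16. Proof. exact: next_D_le (lvS n). Qed.

Lemma lvs_succ_le n : s n.+1 <= s n / 16.
Proof. by apply: (le_trans (next_s_le (lvS n))); rewrite ler_pM2r// lvr_le_lvs. Qed.

Lemma lvmu_ge1 n : 1 <= mu n.+1. Proof. exact: next_mu_ge1 (lvS n). Qed.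

Lemma lvmu_lvr_le n : 200 * (mu n.+1 * r n.+1) <= s n.+1.
Proof.
rewrite mulrA ler_pM2r ?lvr_gt0//; apply: le_trans (next_gain (lvS n)).
rewrite ler_pM2r; last by apply: lt_le_trans (lvmu_ge1 n).
have c2 : 2 <= lvcnt d (lv n) by rewrite lerDr invr_ge0 ltW// lvsig_gt0.
have e1 : 1 <= 2 ^+ n :> R by rewrite exprn_ege1// ler1n.
have h : 1 * 2 <= 2 ^+ n * lvcnt d (lv n) by apply: ler_pM.
have : 1 * 2 * 100 <= 2 ^+ n * lvcnt d (lv n) * K by apply: ler_pM => //; lra.
lra.
Qed.

(** Level 0 only sets the initial time scale and carries no wave, hence the shift of index. *)
Definition wave k (t : R) (j : nat) : R :=
  s k.+1 * tri_wave ((N k.+1)%:R ^+ j * (t / D k.+1)).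

Lemma wave_ge0 k t j : 0 <= wave k t j.
Proof. by rewrite mulr_ge0 ?tri_wave_ge0// ltW// lvs_gt0. Qed.

Lemma wave_le k t j : wave k t j <= s k.+1.
Proof. by rewrite ler_piMr ?tri_wave_le1// ltW// lvs_gt0. Qed.

Lemma wave_dist k t t' j : `|wave k t j - wave k t' j| <= s k.+1.
Proof.
have := wave_ge0 k t j; have := wave_ge0 k t' j.
have := wave_le k t j; have := wave_le k t' j.
by move=> *; rewrite ler_norml; apply/andP; split; lra.
Qed.

Lemma wave_lip k t t' j : (j < d)%N ->
  `|wave k t j - wave k t' j| <= s k.+1 * Q k.+1 / D k.+1 * `|t - t'|.
Proof.
move=> jd; have s0 := lvs_gt0 k.+1; have D0 := lvD_gt0 k.+1.
have -> : s k.+1 * Q k.+1 / D k.+1 * `|t - t'| = s k.+1 * (Q k.+1 * (`|t - t'| / D k.+1)).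
  by rewrite -!mulrA [_^-1 * _]mulrC.
rewrite /wave -mulrBr normrM (gtr0_norm s0) ler_wpM2l ?(ltW s0)//.
apply: (le_trans (tri_wave_lip _ _)); rewrite -mulrBr -mulrBl !normrM normfV.
rewrite (gtr0_norm D0) ler_wpM2r ?mulr_ge0 ?invr_ge0 ?(ltW D0)//.
rewrite ger0_norm ?exprn_ge0//.
by rewrite ler_weXn2l ?ler1n ?lvN_gt0// ltnW.
Qed.

Definition fpart n t j := \sum_(k < n) wave k t j.

Lemma fpart_lip n t t' j : (j < d)%N ->
  `|fpart n t j - fpart n t' j| <= Lip n * `|t - t'|.
Proof.
move=> jd; rewrite /fpart; elim: n => [|n IH].
  by rewrite !big_ord0 subrr normr0 mulr_ge0// lvLip_ge0.
rewrite !big_ord_recr/= opprD addrACA (le_trans (ler_normD _ _))//.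
by rewrite (next_LipE (lvS n)) mulrDl lerD// wave_lip.
Qed.

Definition drift t j := limn (fun n => fpart n t j).

Lemma drift_cvg t j : fpart n t j @[n --> \oo] --> drift t j /\
  forall n, `|drift t j - fpart n t j| <= 2 * s n.+1.
Proof.
have [||l cl hl] := @telescope_cvg R (fun n => fpart n t j) (fun n => s n.+1).
- move=> n; rewrite /fpart big_ord_recr/= addrAC subrr add0r.
  by rewrite ger0_norm ?wave_ge0// wave_le.
- by move=> n; have := lvs_succ_le n.+1; have := lvs_gt0 n.+1; lra.
by rewrite /drift (cvg_lim _ cl).
Qed.

Lemma drift_ge_wave k t j : wave k t j <= drift t j.
Proof.
have [c _] := drift_cvg t j.
rewrite -(cvg_lim _ c)//; apply: limr_ge; first by apply/cvg_ex; exists (drift t j).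
exists k.+1 => // n /= kn; rewrite /fpart (bigD1 (Ordinal kn))//= lerDl.
by apply: sumr_ge0 => i _; exact: wave_ge0.
Qed.

Lemma wave0 k j : wave k 0 j = 0.
Proof.
rewrite /wave mul0r mulr0; have := @tri_waveE R 0 0.
by rewrite mulr0 addr0 lexx ler01 => ->//; rewrite mulr0.
Qed.

Lemma drift0 j : drift 0 j = 0.
Proof.
have e n : fpart n 0 j = 0 by rewrite /fpart big1// => i _; exact: wave0.
by apply: cvg_lim => //; under eq_fun do rewrite e; exact: cvg_cst.
Qed.

(** At this time the slow wave is at its peak, and the other waves, being nonnegative, cannot cancel
    it. As the drift vanishes at 0, its increment over [D] is at least [N * D^H]. *)
Lemma drift_D_ge k : s k.+1 <= drift (D k.+1) 0.
Proof.
apply: le_trans (drift_ge_wave k _ _); rewrite /wave expr0 divff ?gt_eqF ?lvD_gt0//.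
have := @tri_waveE R 0 1; rewrite mulr0 add0r mul1r lexx ler01 => ->//.
by rewrite mulr1.
Qed.

(** The bounds [next_modulus] of the successive scales are summed; the factor 2 is the sum of the
    powers of 1/2. *)
Lemma drift_modulus t t' j : (j < d)%N -> 0 < `|t - t'| <= xi ->
  `|drift t j - drift t' j| <= 2 * (`|t - t'| `^ H * Num.sqrt (ln `|t - t'|^-1)).
Proof.
move=> jd tt'; set M := _ * Num.sqrt _.
have M0 : 0 <= M by rewrite mulr_ge0 ?powR_ge0 ?sqrtr_ge0.
have part n : `|fpart n t j - fpart n t' j| <= (2 - 2 * 2^-1 ^+ n) * M.
  elim: n => [|n IH]; first by rewrite /fpart !big_ord0 subrr normr0 expr0; lra.
  rewrite /fpart !big_ord_recr/= opprD addrACA (le_trans (ler_normD _ _))//.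
  have := next_modulus (lvS n) tt'; rewrite -/M ge_min => h.
  have h' : `|wave n t j - wave n t' j| <= 2^-1 ^+ n * M.
    by case/orP: h => /(le_trans _); apply; [exact: wave_dist|exact: wave_lip].
  by rewrite exprS; move: IH; rewrite /fpart; lra.
have [c _] := drift_cvg t j; have [c' _] := drift_cvg t' j.
have cc : `|fpart n t j - fpart n t' j| @[n --> \oo] --> `|drift t j - drift t' j|.
  by apply: cvg_norm; exact: cvgB.
rewrite -(cvg_lim _ cc)//; apply: limr_le; first by apply/cvg_ex; eexists; exact: cc.
apply: nearW => n; apply: (le_trans (part n)).
by rewrite ler_wpM2r// lerBlDr lerDl mulr_ge0// exprn_ge0.
Qed.

Definition lattice_nbhd (u v : R) : set R :=
  [set x | exists m : int, `|x - m%:~R * u| <= v].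

(** The approximate time of level [n] lies on the lattice of mesh [sig n]; later moves are at most
    [4 * D n.+1] for the first one and decrease at least geometrically by halves, whence the factor
    8. *)
Definition time_set : set R :=
  [set t | 0 <= t <= 8 * D 1 /\ forall n, lattice_nbhd (sig n) (8 * D n.+1) t].

(** The constant 62 is 4 for the grid of the wave, 56 for the increment of the path, 1 for the
    coarser waves and 1 for all finer scales. *)
Definition space_set (M : R) : set R :=
  [set y | `|y| <= M /\
     forall n, lattice_nbhd (s n.+1) (62 * (mu n.+1 * r n.+1)) y].

(** [beta] stands for one path of the process, with time counted from [a]; the hypotheses isolate
    what the good event provides, and the search below is deterministic. *)
Variables (beta : R -> nat -> R) (M0 : R).
Hypothesis beta0 : forall j, (j < d)%N -> `|beta 0 j| <= M0.
Hypothesis beta_incr : forall n m m' j, (j < d)%N -> m%:R * sig n <= 8 * D 1 ->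
  m%:R * sig n <= m'%:R * sig n.+1 <= m%:R * sig n + 4 * D n.+1 ->
  `|beta (m'%:R * sig n.+1) j - beta (m%:R * sig n) j| <= 56 * (mu n.+1 * r n.+1).
Hypothesis beta_cvg : forall (u : nat -> R) t j, (j < d)%N ->
  (forall n, 0 <= u n <= 8 * D 1) -> 0 <= t <= 8 * D 1 ->
  u n @[n --> \oo] --> t -> beta (u n) j @[n --> \oo] --> beta t j.

(* The wave brings each coordinate within [4 * r n.+1] of the next multiple of
   its amplitude [s n.+1]. *)
Lemma hit_step n (m : nat) : exists m' : nat,
  m%:R * sig n <= m'%:R * sig n.+1 <= m%:R * sig n + 4 * D n.+1 /\
  forall j, (j < d)%N -> exists z : int,
    `|beta (m%:R * sig n) j + fpart n (m%:R * sig n) j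
       + wave n (m'%:R * sig n.+1) j - z%:~R * s n.+1| <= 4 * r n.+1.
Proof.
set p := _ * _; have D0 := lvD_gt0 n.+1; have s0 := lvs_gt0 n.+1.
have p0 : 0 <= p by rewrite mulr_ge0// ltW// lvsig_gt0.
pose c j := beta p j + fpart n p j.
(* The fraction of the amplitude that the wave must add to reach the next multiple of [s n.+1]. The
   digit error [4 / N] becomes [4 * r n.+1] after multiplication by [s n.+1]. *)
pose u j := (Num.ceil (c j / s n.+1))%:~R - c j / s n.+1.
have [||k [hk1 hk2]] := @tri_wave_digits R (N n.+1) d u (p / D n.+1) (next_N_gt1 (lvS n)).
- by rewrite divr_ge0// ltW.
- move=> j; have /andP[h1 h2] := ceil_itv (c j / s n.+1).
  by move: h1; rewrite /u intrB => ?; apply/andP; split; lra.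
have e : k%:R * sig n.+1 = k%:R / (N n.+1)%:R ^+ d * D n.+1.
  by rewrite /lvsig /lvQ mulrCA mulrC.
exists k; split.
  rewrite e; case/andP: hk1 => h1 h2; apply/andP; split.
    by rewrite -ler_pdivrMr.
  rewrite -(ler_pM2r D0) in h2; apply: (le_trans h2).
  by rewrite mulrDl divfK// gt_eqF.
move=> j jd; exists (Num.ceil (c j / s n.+1)).
have := hk2 j jd; rewrite /wave e mulfK ?gt_eqF//; set w := tri_wave _ => hw.
have -> : beta p j + fpart n p j + s n.+1 * w - (Num.ceil (c j / s n.+1))%:~R * s n.+1
   = s n.+1 * (w - u j).
  by rewrite -/(c j) /u; field; rewrite gt_eqF.
rewrite normrM gtr0_norm//; apply: (@le_trans _ _ (s n.+1 * (4 / (N n.+1)%:R))).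
  by rewrite ler_pM2l.
by rewrite /lvs mulrAC mulrCA mulfV ?mulr1// pnatr_eq0 -lt0n lvN_gt0.
Qed.

(** [w n] is the position at the approximate time [t n] with only the first [n] waves. Both
    sequences move by at least geometrically decreasing amounts, so each lattice constraint, once
    acquired, survives in the limit up to a small loss. *)
Lemma hit : exists2 t, time_set t &
  forall j, (j < d)%N -> space_set (M0 + 1) (beta t j + drift t j).
Proof.
have [nx hnx] := choice (fun p : nat * nat => hit_step p.1 p.2).
pose fix m n := if n is k.+1 then nx (k, m k) else 0%N.
pose t n := (m n)%:R * sig n.
have tS n : t n <= t n.+1 <= t n + 4 * D n.+1 by exact: (hnx (n, m n)).1.
have t00 : t 0%N = 0 by rewrite /t mul0r.
have td n : `|t n.+1 - t n| <= 4 * D n.+1.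
  by have /andP[? ?] := tS n; rewrite ger0_norm; lra.
have De n : 4 * D n.+2 <= 4 * D n.+1 / 2.
  by have := lvD_succ_le n.+1; have := lvD_gt0 n.+1; lra.
have [T ct hT] := @telescope_cvg R t (fun n => 4 * D n.+1) td De.
have t_ge0 n : 0 <= t n by rewrite mulr_ge0// ltW// lvsig_gt0.
have t_le n : t n <= 8 * D 1.
  have := @telescope_le R t _ 0%N td De n (leq0n n).
  by rewrite t00 subr0 ger0_norm//; lra.
have T_itv : 0 <= T <= 8 * D 1.
  have := hT 0%N; rewrite t00 subr0 => h.
  have T0 : 0 <= T.
    rewrite -(cvg_lim _ ct)//; apply: limr_ge; first by apply/cvg_ex; exists T.
    exact: nearW.
  by rewrite T0/=; move: h; rewrite ger0_norm//; lra.
exists T.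
  split => // n; exists (Posz (m n)); rewrite -pmulrn -/(t n).
  by have := hT n; lra.
move=> j jd; pose w n := beta (t n) j + fpart n (t n) j.
have w_step n : exists2 z : int, `|w n.+1 - z%:~R * s n.+1| <= 61 * (mu n.+1 * r n.+1)
    & `|w n.+1 - w n| <= 2 * s n.+1.
  have [z hz] := (hnx (n, m n)).2 j jd; rewrite /= -/(t n) -/(t n.+1) in hz.
  have r0 := lvr_gt0 n.+1.
  have mur : r n.+1 <= mu n.+1 * r n.+1 by rewrite ler_peMl ?lvmu_ge1// ltW.
  have b1 : `|beta (t n.+1) j - beta (t n) j| <= 56 * (mu n.+1 * r n.+1).
    by apply: beta_incr => //; [exact: t_le|exact: tS].
  (* The Lipschitz constant of the coarser waves was known before [D n.+1] was chosen, so they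
     hardly move during the step. *)
  have b2 : `|fpart n (t n.+1) j - fpart n (t n) j| <= r n.+1.
    apply: (le_trans (fpart_lip _ _ _ jd)).
    apply: (@le_trans _ _ (Lip n * (4 * D n.+1))); first by rewrite ler_wpM2l ?lvLip_ge0.
    have := next_Lip_le (lvS n).
    have : 0 <= Lip n * D n.+1 by rewrite mulr_ge0 ?lvLip_ge0// ltW// lvD_gt0.
    lra.
  have wE : w n.+1 = beta (t n.+1) j + fpart n (t n.+1) j + wave n (t n.+1) j.
    by rewrite /w /fpart big_ord_recr/= addrA.
  exists z.
    have -> : w n.+1 - z%:~R * s n.+1 =
      (beta (t n) j + fpart n (t n) j + wave n (t n.+1) j - z%:~R * s n.+1)
      + ((beta (t n.+1) j - beta (t n) j) + (fpart n (t n.+1) j - fpart n (t n) j)).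
      by rewrite wE; ring.
    apply: (le_trans (ler_normD _ _)).
    have := ler_normD (beta (t n.+1) j - beta (t n) j) (fpart n (t n.+1) j - fpart n (t n) j).
    lra.
  have -> : w n.+1 - w n = wave n (t n.+1) j
      + ((beta (t n.+1) j - beta (t n) j) + (fpart n (t n.+1) j - fpart n (t n) j)).
    by rewrite wE /w; ring.
  apply: (le_trans (ler_normD _ _)); rewrite (ger0_norm (wave_ge0 _ _ _)).
  have := ler_normD (beta (t n.+1) j - beta (t n) j) (fpart n (t n.+1) j - fpart n (t n) j).
  have := wave_le n (t n.+1) j; have := lvmu_lvr_le n; lra.
have wd n : `|w n.+1 - w n| <= 2 * s n.+1 by case: (w_step n).
have se n : 2 * s n.+2 <= 2 * s n.+1 / 2.
  by have := lvs_succ_le n.+1; have := lvs_gt0 n.+1; lra.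
have [y cy hy] := @telescope_cvg R w (fun n => 2 * s n.+1) wd se.
have s_cvg0 : s n.+1 @[n --> \oo] --> 0.
  apply: geom_cvg0 => n; first exact: ltW (lvs_gt0 _).
  by have := lvs_succ_le n.+1; have := lvs_gt0 n.+1; lra.
have fcvg : fpart n (t n) j @[n --> \oo] --> drift T j.
  have [_ hf] := drift_cvg T j.
  apply/cvgrPdist_le => e e0; near=> n.
  apply: (@le_trans _ _ (4 * s n.+1)).
    have -> : drift T j - fpart n (t n) j
      = (drift T j - fpart n T j) + (fpart n T j - fpart n (t n) j) by ring.
    apply: (le_trans (ler_normD _ _)).
    have b3 : `|fpart n T j - fpart n (t n) j| <= 2 * s n.+1.
      apply: (le_trans (fpart_lip _ _ _ jd)).
      apply: (@le_trans _ _ (Lip n * (2 * (4 * D n.+1)))); first by rewrite ler_wpM2l ?lvLip_ge0.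
      have := next_Lip_le (lvS n); have := lvr_le_lvs n.+1; have := lvr_gt0 n.+1; lra.
    by have := hf n; lra.
  have : s n.+1 <= e / 4.
    by near: n; apply: (cvgr_le _ s_cvg0); rewrite divr_gt0.
  lra.
have yE : y = beta T j + drift T j.
  have c1 : w n @[n --> \oo] --> beta T j + drift T j.
    by apply: cvgD => //; apply: beta_cvg => // n; rewrite t_ge0 t_le.
  by rewrite -(cvg_lim _ cy)// -(cvg_lim _ c1).
rewrite -yE; split.
  have w0 : `|w 0%N| <= M0.
    by rewrite /w /fpart big_ord0 addr0 t00 beta0.
  have r01 : r 0%N <= 1.
    rewrite /lvr lv0/=; case/andP: H01 => h0 _; case/andP: Dz_itv => x0 x1.
    have e : 1 `^ H = 1 :> R by rewrite powR1.
    by rewrite -[leRHS]e ge0_ler_powR ?nnegrE// ltW.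
  have := next_s_le (lvS 0%N).
  have := hy 0%N; have := ler_normD (y - w 0%N) (w 0%N); rewrite subrK; lra.
move=> n; have [z hz _] := w_step n; exists z.
have mur : r n.+1 <= mu n.+1 * r n.+1 by rewrite ler_peMl ?lvmu_ge1// ltW// lvr_gt0.
have := next_s_le (lvS n.+1); have := hy n.+1.
have := ler_normD (y - w n.+1) (w n.+1 - z%:~R * s n.+1); rewrite addrA subrK.
have := lvr_gt0 n.+1; lra.
Unshelve. all: by end_near. Qed.

(** The distance to a lattice is a rescaled triangle wave; closedness of the neighbourhood thus
    follows from its continuity. *)
Lemma lattice_nbhdE (u v : R) : 0 < u ->
  lattice_nbhd u v = [set x | u / 2 * tri_wave (2 * (x / u)) <= v].
Proof.
move=> u0; have e x (m : int) : `|x - m%:~R * u| = u / 2 * `|2 * (x / u) - 2 * m%:~R|.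
  have -> : u / 2 = `|u / 2| by rewrite gtr0_norm// divr_gt0.
  by rewrite -normrM; congr `|_|; field; rewrite gt_eqF.
apply/seteqP; split => x /= [].
  move=> m; rewrite e; apply: le_trans; rewrite ler_wpM2l ?tri_wave_le//.
  by rewrite divr_ge0// ltW.
by move=> h; eexists; rewrite e; exact: h.
Qed.

Lemma closed_lattice_nbhd (u v : R) : 0 < u -> closed (lattice_nbhd u v).
Proof.
move=> u0; rewrite lattice_nbhdE//.
have c : continuous (fun x : R => u / 2 * tri_wave (2 * (x / u))).
  move=> x; apply/cvgrPdist_le => e e0; near=> y.
  rewrite -mulrBr normrM gtr0_norm ?divr_gt0//.
  apply: (@le_trans _ _ (u / 2 * `|2 * (x / u) - 2 * (y / u)|)).
    by rewrite ler_wpM2l ?tri_wave_lip// divr_ge0// ltW.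
  rewrite -mulrBr -mulrBl !normrM normfV (gtr0_norm u0) ger0_norm//.
  have -> : u / 2 * (2 * (`|x - y| / u)) = `|x - y| by field; rewrite gt_eqF.
  by near: y; exact: cvgr_dist_le.
rewrite (_ : [set x | _] = (fun x : R => u / 2 * tri_wave (2 * (x / u))) @^-1` [set y | y <= v])//.
by apply: closed_comp => // x _; exact: c.
Unshelve. all: by end_near. Qed.

Lemma time_set_compact : compact time_set.
Proof.
apply: (@subclosed_compact _ _ `[0, 8 * D 1]%classic); last 2 first.
- exact: segment_compact.
- by move=> t [+ _]; rewrite /= in_itv.
rewrite (_ : time_set = `[0, 8 * D 1]%classic `&`
    \bigcap_n lattice_nbhd (sig n) (8 * D n.+1)).
  apply: closedI; first exact: itv_closed.
  by apply: closed_bigI => n _; apply: closed_lattice_nbhd; exact: lvsig_gt0.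
apply/seteqP; split => t [h1 h2].
  by split; [rewrite /= in_itv | move=> n _; exact: h2].
by split; [move: h1; rewrite /= in_itv | move=> n; exact: h2].
Qed.

Lemma space_set_compact (M : R) : compact (space_set M).
Proof.
apply: (@subclosed_compact _ _ `[- M, M]%classic); last 2 first.
- exact: segment_compact.
- by move=> y [+ _]; rewrite /= in_itv/= ler_norml.
rewrite (_ : space_set M = `[- M, M]%classic `&`
    \bigcap_n lattice_nbhd (s n.+1) (62 * (mu n.+1 * r n.+1))).
  apply: closedI; first exact: itv_closed.
  by apply: closed_bigI => n _; apply: closed_lattice_nbhd; exact: lvs_gt0.
apply/seteqP; split => t [h1 h2].
  by split; [rewrite /= in_itv/= -ler_norml | move=> n _; exact: h2].
by split; [move: h1; rewrite /= in_itv/= -ler_norml | move=> n; exact: h2].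
Qed.

(** * Counting covers of the targets *)

Definition grid_size (u B : R) : nat := (Num.truncn (B / u)).+1.

Lemma grid_size_le (u B : R) : 0 < u -> 0 <= B ->
  (2 * grid_size u B).+1%:R <= 2 * B / u + 3 :> R.
Proof.
move=> u0 B0; have Bu : 0 <= B / u by rewrite divr_ge0// ltW.
have /andP[h _] := truncn_itv Bu.
by rewrite /grid_size -natr1 natrM -natr1; lra.
Qed.

Lemma lattice_nbhd_index (u v B x : R) : 0 < u -> `|x| <= B -> lattice_nbhd u v x ->
  exists i : 'I_(2 * grid_size u (B + v)).+1,
    `|x - (i%:R - (grid_size u (B + v))%:R) * u| <= v.
Proof.
move=> u0 xB [m hm]; set Z := grid_size _ _.
have mZ : `|m%:~R| < Z%:R :> R.
  apply: le_lt_trans (_ : (B + v) / u < _); last first.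
    have h : 0 <= (B + v) / u.
      by rewrite divr_ge0 ?(ltW u0)// addr_ge0// (le_trans _ xB, le_trans _ hm).
    by have /andP[_] := truncn_itv h.
  rewrite ler_pdivlMr// -{1}(gtr0_norm u0) -normrM.
  have := ler_normB x (x - m%:~R * u); rewrite subKr; lra.
pose k : int := m + Z%:Z.
have [h1 h2] : 0 <= k /\ k <= (2 * Z)%:Z.
  move: mZ; rewrite ltr_norml => /andP[]; rewrite /k pmulrn -mulrNz !ltr_int => hk1 hk2.
  by clear -hk1 hk2; split; lia.
have k2 : (absz k < (2 * Z).+1)%N by clear -h1 h2; lia.
exists (Ordinal k2) => /=.
suff -> : (absz k)%:R - Z%:R = m%:~R :> R by [].
by rewrite [(absz k)%:R]pmulrn gez0_abs// /k intrD -pmulrn addrK.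
Qed.

Definition cell (tau eta : R) (c : R * 'rV[R]_d) : set (R * 'rV[R]_d) :=
  [set u : R * 'rV[R]_d | `|u.1 - c.1| <= tau /\ forall j, `|u.2 ord0 j - c.2 ord0 j| <= eta].

Lemma lvs_le1 n : s n.+1 <= 1.
Proof.
have r01 : r 0%N <= 1.
  rewrite /lvr lv0/=; case/andP: H01 => h0 _; case/andP: Dz_itv => x0 x1.
  have e : 1 `^ H = 1 :> R by rewrite powR1.
  by rewrite -[leRHS]e ge0_ler_powR ?nnegrE// ltW.
elim: n => [|n IH]; first by have := next_s_le (lvS 0%N); lra.
by have := lvs_succ_le n.+1; have := lvs_gt0 n.+1; lra.
Qed.

Lemma lvD_le n : D n.+1 <= D 1.
Proof.
by elim: n => // n IH; have := lvD_succ_le n.+1; have := lvD_gt0 n.+1; lra.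
Qed.

Lemma lvD1_le : 16 * D 1 <= 1.
Proof. by have := lvD_succ_le 0; rewrite lv0/=; case/andP: Dz_itv => ? ?; lra. Qed.

Variables (a M : R).

Definition time_target : set R := [set t | time_set (t - a)].
Definition space_target : set 'rV[R]_d :=
  [set y : 'rV[R]_d | forall j, space_set M (y ord0 j)].

(* [N1] counts the windows of the time set and [N2] the lattice points of each
   coordinate; all factors depending on the scale cancel except [N n.+1]. *)
Lemma cover_count_le n (c : R) (N1 N2 : nat) : (0 < d)%N -> 0 <= M -> 0 <= c ->
  2 * c * (2 * M + 5) <= K ->
  N1%:R <= 2 * lvcnt d (lv n) -> N2%:R <= (2 * M + 5) / s n.+1 ->
  N1%:R * (N2%:R * (c * (mu n.+1 * r n.+1))) ^+ d <= 2^-1 ^+ n.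
Proof.
move=> d0 M_ge0 c0 cK hN1 hN2.
have s0 := lvs_gt0 n.+1; have r0 := lvr_gt0 n.+1; have mu1 := lvmu_ge1 n.
have mu0 : 0 < mu n.+1 by lra.
have cnt2 : 2 <= lvcnt d (lv n) by rewrite lerDr invr_ge0 ltW// lvsig_gt0.
have cnt0 : 0 < lvcnt d (lv n) by lra.
have e2 : 1 <= 2 ^+ n :> R by rewrite exprn_ege1// ler1n.
pose q := (2 * 2 ^+ n * lvcnt d (lv n))^-1.
have q1 : 1 <= 2 * 2 ^+ n * lvcnt d (lv n).
  have h : 1 * 2 <= 2 ^+ n * lvcnt d (lv n) by apply: ler_pM.
  by rewrite -mulrA; lra.
have qV0 : 0 < 2 * 2 ^+ n * lvcnt d (lv n) by lra.
have q0 : 0 < q by rewrite invr_gt0.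
have qle1 : q <= 1 by rewrite invf_le1.
have N0 : 0 < (N n.+1)%:R :> R by rewrite ltr0n lvN_gt0.
have x0 : 0 <= c * (mu n.+1 * r n.+1) by rewrite mulr_ge0// mulr_ge0// ltW.
have base : N2%:R * (c * (mu n.+1 * r n.+1)) <= q.
  apply: (@le_trans _ _ ((2 * M + 5) / s n.+1 * (c * (mu n.+1 * r n.+1)))).
    by rewrite ler_wpM2r.
  have -> : (2 * M + 5) / s n.+1 * (c * (mu n.+1 * r n.+1))
     = 2 * c * (2 * M + 5) * mu n.+1 / (2 * (N n.+1)%:R).
    by rewrite /lvs; field; rewrite !gt_eqF.
  rewrite /q ler_pdivrMr ?mulr_gt0// [leRHS]mulrC ler_pdivlMr//.
  apply: (@le_trans _ _ (K * (mu n.+1 * (2 * 2 ^+ n * lvcnt d (lv n))))).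
    by rewrite -[leLHS]mulrA ler_wpM2r// mulr_ge0// ltW.
  have -> : K * (mu n.+1 * (2 * 2 ^+ n * lvcnt d (lv n)))
    = 2 * (2 ^+ n * lvcnt d (lv n) * K * mu n.+1) by ring.
  by rewrite ler_pM2l//; exact: next_gain (lvS n).
have y0 : 0 <= N2%:R * (c * (mu n.+1 * r n.+1)) by rewrite mulr_ge0.
(* With [q <= 1] and [0 < d], the gain of a single coordinate suffices; [q] is chosen to cancel the
   number of windows. *)
have pw : (N2%:R * (c * (mu n.+1 * r n.+1))) ^+ d <= q.
  apply: (@le_trans _ _ (q ^+ d)); first by rewrite lerXn2r ?nnegrE// ltW.
  by rewrite -[leRHS]expr1 ler_wiXn2l// ltW.
apply: (@le_trans _ _ (2 * lvcnt d (lv n) * q)).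
  by apply: ler_pM => //; exact: exprn_ge0.
rewrite /q exprVn le_eqVlt; apply/orP; left; apply/eqP; field.
by rewrite !gt_eqF//; lra.
Qed.

Lemma target_cover n : (0 < d)%N -> 0 <= M -> 500 * d%:R * (2 * M + 5) <= K ->
  16 * D 1 <= a ->
  exists (Nn : nat) (c : nat -> R * 'rV[R]_d),
  [/\ (0 < Nn)%N, forall i, 0 <= (c i).1,
    time_target `*` space_target `<=`
      \bigcup_(i in `I_Nn) cell (8 * D n.+1) (62 * (mu n.+1 * r n.+1)) (c i)
    & Nn%:R * (250 * d%:R * (mu n.+1 * r n.+1)) ^+ d <= 2^-1 ^+ n].
Proof.
move=> d0 M_ge0 K_big a16.
have s0 := lvs_gt0 n.+1; have s1 := lvs_le1 n; have r0 := lvr_gt0 n.+1.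
have mu1 := lvmu_ge1 n; have mus := lvmu_lvr_le n; have sg0 := lvsig_gt0 n.
have mur0 : 0 < mu n.+1 * r n.+1 by rewrite mulr_gt0//; lra.
have D1 := lvD1_le; have Dn1 := lvD_le n; have D0 := lvD_gt0 n.+1.
pose BT := 8 * D 1 + 8 * D n.+1; pose ZT := grid_size (sig n) BT.
pose BS := M + 62 * (mu n.+1 * r n.+1); pose ZS := grid_size (s n.+1) BS.
(* The centres have to be in the half-space, hence the maximum. *)
pose T : finType := ('I_(2 * ZT).+1 * {ffun 'I_d -> 'I_(2 * ZS).+1})%type.
pose ctr (p : T) : R * 'rV[R]_d :=
  (Num.max 0 (a + (p.1%:R - ZT%:R) * sig n), \row_j (((p.2 j)%:R - ZS%:R) * s n.+1)).
pose c i := nth (0, 0) [seq ctr p | p <- enum T] i.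
exists #|T|, c; split.
- by rewrite card_prod card_ffun !card_ord muln_gt0 expn_gt0.
- move=> i; rewrite /c; have [iT|iT] := ltnP i (size (enum T)); last first.
    by rewrite nth_default; [|rewrite size_map].
  have /hasP[p0 _ _] : has predT (enum T) by rewrite has_predT; case: (enum T) iT.
  by rewrite (nth_map p0)// /ctr /= le_max lexx.
- move=> [t y] [/= [tD1 tl] yS].
  have [|p1 hp1] := @lattice_nbhd_index (sig n) (8 * D n.+1) (8 * D 1) (t - a) sg0 _ (tl n).
    by rewrite ger0_norm; case/andP: tD1.
  have hp2 j : exists i : 'I_(2 * ZS).+1,
      `|y ord0 j - (i%:R - ZS%:R) * s n.+1| <= 62 * (mu n.+1 * r n.+1).
    by have [yM yl] := yS j; apply: lattice_nbhd_index.
  have [p2 hp2'] := choice hp2.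
  pose p : T := (p1, [ffun j => p2 j]).
  exists (enum_rank p); first exact: ltn_ord.
  rewrite /c (nth_map p) ?nth_enum_rank; last by rewrite -cardE ltn_ord.
  split => /=; last by move=> j; rewrite mxE ffunE.
  have t_ge : a <= t by case/andP: tD1 => h _; rewrite -subr_ge0.
  have e : t - (a + (p1%:R - ZT%:R) * sig n) = t - a - (p1%:R - ZT%:R) * sig n by ring.
  have [h|h] := leP 0 (a + (p1%:R - ZT%:R) * sig n); first by rewrite e.
  rewrite subr0 ger0_norm; last lra.
  by move: hp1; rewrite -/ZT -e ger0_norm; lra.
have NT : (2 * ZT).+1%:R <= 2 * lvcnt d (lv n).
  apply: (le_trans (grid_size_le sg0 _)); first by rewrite /BT; have := lvD_gt0 1; lra.
  have : 2 * BT / sig n <= 2 / sig n by rewrite ler_pM2r ?invr_gt0//; rewrite /BT; lra.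
  rewrite /lvcnt; lra.
have NS : (2 * ZS).+1%:R <= (2 * M + 5) / s n.+1.
  apply: (le_trans (grid_size_le s0 _)); first by rewrite /BS; lra.
  rewrite ler_pdivlMr// mulrDl divfK ?gt_eqF// /BS; lra.
rewrite card_prod card_ffun !card_ord natrM natrX -mulrA -exprMn.
apply: cover_count_le => //; apply: le_trans K_big.
by rewrite le_eqVlt; apply/orP; left; apply/eqP; ring.
Qed.

Lemma closed_cell (tau eta : R) (c : R * 'rV[R]_d) : closed (cell tau eta c).
Proof.
rewrite (_ : cell tau eta c = [set u : R * 'rV[R]_d | `|u.1 - c.1| <= tau] `&`
   \bigcap_(j in [set: 'I_d]) [set u : R * 'rV[R]_d | `|u.2 ord0 j - c.2 ord0 j| <= eta]).
  apply: closedI.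
    rewrite (_ : [set u | _] =
      (fun u : R * 'rV[R]_d => `|u.1 - c.1|) @^-1` [set y | y <= tau])//.
    apply: closed_comp => // u _; apply: cvg_norm; apply: cvgB; last exact: cvg_cst.
    exact: cvg_fst.
  apply: closed_bigI => j _.
  rewrite (_ : [set u | _] =
      (fun u : R * 'rV[R]_d => `|u.2 ord0 j - c.2 ord0 j|) @^-1` [set y | y <= eta])//.
  apply: closed_comp => // u _; apply: cvg_norm; apply: cvgB; last exact: cvg_cst.
  apply: (@cvg_comp _ _ _ snd (fun y : 'rV[R]_d => y ord0 j)); first exact: cvg_snd.
  exact: coord_continuous.
by apply/seteqP; split => u [h1 h2]; split => // j; [move=> _; exact: h2|exact: h2].
Qed.

(** Two points of a cell differ by at most [124 = 2 * 62] units in each coordinate; one more unit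
    makes the inequality strict, so that open balls can be used, and [d] passes from coordinates to
    the Euclidean norm. *)
Definition rad n := 125 * d%:R * (mu n.+1 * r n.+1).

Lemma rad_gt0 n : (0 < d)%N -> 0 < rad n.
Proof.
move=> d0; rewrite !mulr_gt0 ?ltr0n ?lvr_gt0//; apply: lt_le_trans (lvmu_ge1 n); lra.
Qed.

Lemma parabolic_dist_lt_rad n (x x' : R) (y y' : 'rV[R]_d) : (0 < d)%N ->
  `|x' - x| <= 16 * D n.+1 ->
  (forall j, `|y ord0 j - y' ord0 j| <= 124 * (mu n.+1 * r n.+1)) ->
  parabolic_dist H (x, y) (x', y') < rad n.
Proof.
move=> d0 hx hy; have r0 := lvr_gt0 n.+1; have mu1 := lvmu_ge1 n.
have mur : r n.+1 <= mu n.+1 * r n.+1 by rewrite ler_peMl// ltW.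
have mur0 : 0 < mu n.+1 * r n.+1 by lra.
have dR : 1 <= d%:R :> R by rewrite ler1n.
have dmur : mu n.+1 * r n.+1 <= d%:R * (mu n.+1 * r n.+1) by rewrite ler_peMl// ltW.
have /andP[H0 H1] := H01; have D0 := lvD_gt0 n.+1.
rewrite /parabolic_dist gt_max /=; apply/andP; split.
  apply: (@le_lt_trans _ _ (16 * r n.+1)); last by rewrite /rad; lra.
  apply: (@le_trans _ _ ((16 * D n.+1) `^ H)).
    by rewrite ge0_ler_powR ?nnegrE ?(ltW H0)// mulr_ge0// ltW.
  rewrite powRM ?(ltW D0)// ler_wpM2r ?(ltW r0)//.
  by rewrite -[leRHS]powRr1// ler_powR ?(ltW H1)//; lra.
apply: (@le_lt_trans _ _ (d%:R * (124 * (mu n.+1 * r n.+1)))).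
  by apply: enorm_le => [|j]; [lra|rewrite !mxE; exact: hy].
by rewrite /rad; lra.
Qed.

Lemma rad_le_lvs n : rad n <= d%:R * s n.+1.
Proof.
have := lvmu_lvr_le n; have := lvs_gt0 n.+1 => s0 h.
rewrite /rad mulrAC [_ * d%:R]mulrC ler_wpM2l//; lra.
Qed.

Hypotheses (d_gt0 : (0 < d)%N) (M_ge0 : 0 <= M)
  (K_big : 500 * d%:R * (2 * M + 5) <= K) (D1_le_a : 16 * D 1 <= a).

Lemma target_capacity :
  capacity (@parabolic_dist R d H) d%:R (time_target `*` space_target) = 0%E.
Proof.
apply: capacity_eq0 => eps eps0.
have [n hn] : exists n, 2^-1 ^+ n <= eps :> R.
  have : \forall n \near \oo, (2^-1 : R) ^+ n <= eps.
    apply: cvgr_le eps0; apply: cvg_expr; rewrite ger0_norm; lra.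
  by move=> /filter_ex.
have [Nn [c [N0 _ cov small]]] := target_cover n d_gt0 M_ge0 K_big D1_le_a.
exists Nn, (cell (8 * D n.+1) (62 * (mu n.+1 * r n.+1)) \o c), ((2 * rad n) ^+ d).
have rad2 : 2 * rad n = 250 * d%:R * (mu n.+1 * r n.+1) by rewrite /rad; ring.
have r0 := rad_gt0 n d_gt0.
split => //.
- by split => //; rewrite exprn_gt0// mulr_gt0.
- by move=> i; exact: closed_cell.
- move=> i [x y] [x' y'] [/= h1 h2] [/= h1' h2'].
  have rho_lt : parabolic_dist H (x, y) (x', y') < rad n.
    apply: parabolic_dist_lt_rad => // [|j].
      have := ler_normB (x' - (c i).1) (x - (c i).1).
      have -> : x' - (c i).1 - (x - (c i).1) = x' - x by ring.
      lra.
    have := ler_normB (y ord0 j - (c i).2 ord0 j) (y' ord0 j - (c i).2 ord0 j).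
    have -> : y ord0 j - (c i).2 ord0 j - (y' ord0 j - (c i).2 ord0 j)
      = y ord0 j - y' ord0 j by ring.
    by have := h2 j; have := h2' j; lra.
  have rho0 : 0 <= parabolic_dist H (x, y) (x', y') by rewrite le_max powR_ge0.
  rewrite powR_mulrn// lerXn2r ?nnegrE//; first by rewrite mulr_ge0// ltW.
  by lra.
- by rewrite rad2 (le_trans small).
Qed.

Lemma target_hausdorff :
  hausdorff_measure (@parabolic_space R d) (@parabolic_dist R d H) d%:R
    (time_target `*` space_target) = 0%E.
Proof.
apply: hausdorff_measure_eq0; first by rewrite pnatr_eq0 -lt0n.
move=> del eps del0 eps0.
have s_cvg0 : s n.+1 @[n --> \oo] --> 0.
  apply: geom_cvg0 => n; first exact: ltW (lvs_gt0 _).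
  by have := lvs_succ_le n.+1; have := lvs_gt0 n.+1; lra.
have dR : 0 < d%:R :> R by rewrite ltr0n.
have [n [hn hs]] : exists n, 2^-1 ^+ n <= eps /\ s n.+1 <= del / d%:R.
  suff : \forall n \near \oo, (2^-1 : R) ^+ n <= eps /\ s n.+1 <= del / d%:R.
    by move=> /filter_ex.
  near=> n; split; near: n.
    by apply: cvgr_le eps0; apply: cvg_expr; rewrite ger0_norm; lra.
  by apply: (cvgr_le _ s_cvg0); rewrite divr_gt0.
have [Nn [c [N0 c0 cov small]]] := target_cover n d_gt0 M_ge0 K_big D1_le_a.
have rad2 : 2 * rad n = 250 * d%:R * (mu n.+1 * r n.+1) by rewrite /rad; ring.
have r0 := rad_gt0 n d_gt0.
exists Nn, c, (rad n); split.
- rewrite ltW//=; apply: (le_trans (rad_le_lvs n)).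
  by rewrite mulrC -ler_pdivlMr.
- exact: c0.
- move=> [x y] xy; have [i /= iN [/= h1 h2]] := cov _ xy.
  case: xy => -[/= /andP[x0 _] _] _.
  exists i => //; split; first by rewrite /parabolic_space /=; move: D1_le_a (lvD_gt0 1); lra.
  case: (c i) h1 h2 => x' y' /= h1 h2.
  have D0 := lvD_gt0 n.+1; have mu1 := lvmu_ge1 n.
  have mur0 : 0 < mu n.+1 * r n.+1 by rewrite mulr_gt0 ?lvr_gt0//; lra.
  by apply: parabolic_dist_lt_rad => // [|j]; [|rewrite distrC; have := h2 j]; lra.
- rewrite powR_mulrn; last by rewrite mulr_ge0// ltW.
  by rewrite rad2 (le_trans small).
Unshelve. all: by end_near. Qed.

(** * Regularity of the drift *)

Hypothesis xi01 : 0 < xi < 1.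

Lemma drift_continuous j : (j < d)%N -> continuous (fun t : R => drift t j).
Proof.
move=> jd t; have [H0 H1] := andP H01; have [xi0 xi1] := andP xi01.
apply/cvgrPdist_le => e e0.
have c0 : 0 < H * (e / 2) ^+ 2 by rewrite mulr_gt0// exprn_gt0// divr_gt0.
have := near_powR_le H0 c0.
rewrite /at_right /within /= => /nbhs_ballP[del /= del0 hdel].
near=> t'.
have [->|tt'] := eqVneq t t'; first by rewrite subrr normr0 ltW.
have tt0 : 0 < `|t - t'| by rewrite normr_gt0 subr_eq0.
have txi : 0 < `|t - t'| <= xi by rewrite tt0/=; near: t'; exact: cvgr_dist_le.
apply: (le_trans (drift_modulus jd txi)).
have hp : `|t - t'| `^ H <= H * (e / 2) ^+ 2.
  apply: hdel => //; rewrite /ball/= sub0r normrN normr_id.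
  by near: t'; exact: cvgr_dist_lt.
apply: (@le_trans _ _ (2 * Num.sqrt ((e / 2) ^+ 2))).
  rewrite ler_pM2l//; apply: (le_trans (powR_sqrt_ln_le H0 tt0)).
  by rewrite ler_wsqrtr// ler_pdivrMr// mulrC.
by rewrite sqrtr_sqr ger0_norm ?divr_ge0 ?(ltW e0)//; lra.
Unshelve. all: by end_near. Qed.

Definition drift_fun (t : R) : 'rV[R]_d := \row_j drift (t - a) j.

Lemma drift_shift_continuous j : (j < d)%N -> continuous (fun t : R => drift (t - a) j).
Proof.
move=> jd t; apply: (@cvg_comp _ _ _ (fun t => t - a) (fun t => drift t j)).
  by apply: cvgB; [exact: cvg_id|exact: cvg_cst].
exact: drift_continuous.
Qed.

Lemma drift_fun_continuous : continuous drift_fun.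
Proof.
move=> t; apply/cvgrPdist_le => e e0.
have h : \forall t' \near t, forall j : 'I_d, `|drift (t - a) j - drift (t' - a) j| <= e.
  apply: (@filter_forall _ _ (fun (j : 'I_d) (t' : R) =>
    `|drift (t - a) j - drift (t' - a) j| <= e) (nbhs t)) => j.
  have /cvgrPdist_le := drift_shift_continuous (ltn_ord j) (x := t); exact.
near=> t'.
have hj : forall j : 'I_d, `|drift (t - a) j - drift (t' - a) j| <= e by near: t'.
rewrite /Num.norm/= mx_normrE bigmax_le ?(ltW e0)// => -[i j] _ /=.
by rewrite !mxE; exact: hj.
Unshelve. all: by end_near. Qed.

Lemma drift_fun_modulus (w : R -> R) (b c : R) : b - a <= xi -> 0 < c ->
  (forall x, 0 < x <= 1 -> c * (x `^ H * Num.sqrt (ln x^-1)) <= w x) ->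
  modulus_space w `[a, b] drift_fun.
Proof.
move=> abxi c0 hw; have [xi0 xi1] := andP xi01; split.
  by apply: continuous_subspaceT; exact: drift_fun_continuous.
apply: (@le_lt_trans _ _ (d%:R * 2 / c)%:E); last exact: ltry.
apply: ge_ereal_sup => _ [t [t' [+ + tt' ->]]].
rewrite /= !in_itv/= => /andP[t1 t2] /andP[t1' t2'].
have st0 : 0 < `|t - t'| by rewrite normr_gt0 subr_eq0.
have stxi : `|t - t'| <= xi by rewrite ler_norml; apply/andP; split; lra.
set x := `|t - t'|; pose m := x `^ H * Num.sqrt (ln x^-1).
(* Distances stay below [xi < 1], so the logarithm is positive and the quotient by [w] has its usual
   meaning. *)
have m0 : 0 < m.
  rewrite mulr_gt0 ?powR_gt0// sqrtr_gt0 ln_gt0// invf_gt1//.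
  by apply: le_lt_trans xi1.
have wm : c * m <= w x by apply: hw; rewrite st0/=; apply: le_trans stxi (ltW xi1).
have w0 : 0 < w x by apply: lt_le_trans wm; rewrite mulr_gt0.
have en : enorm (drift_fun t - drift_fun t') <= d%:R * (2 * m).
  apply: enorm_le => [|j]; first by rewrite mulr_ge0// ltW.
  rewrite !mxE /m (_ : x = `|t - a - (t' - a)|); last by rewrite opprB addrA subrK.
  apply: drift_modulus => //; rewrite opprB addrA subrK//.
  by rewrite st0.
rewrite inver gt_eqF// -EFinM lee_fin ler_pdivrMr//.
apply: (le_trans en); apply: (@le_trans _ _ (d%:R * 2 / c * (c * m))).
  by rewrite le_eqVlt; apply/orP; left; apply/eqP; field; rewrite gt_eqF.
by rewrite ler_wpM2l// !mulr_ge0// invr_ge0 ltW.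
Qed.

Lemma pow2_le_lvN n : 2 ^+ n <= (N n.+1)%:R :> R.
Proof.
apply: le_trans (next_gain (lvS n)).
have c2 : 2 <= lvcnt d (lv n) by rewrite lerDr invr_ge0 ltW// lvsig_gt0.
have mu1 := lvmu_ge1 n; have K100 := K_ge.
have h1 : 1 * 1 <= lvcnt d (lv n) * K by apply: ler_pM => //; lra.
have h2 : 1 * 1 <= lvcnt d (lv n) * K * mu n.+1 by apply: ler_pM => //; lra.
have e2 : 0 <= 2 ^+ n :> R by rewrite exprn_ge0.
have -> : 2 ^+ n * lvcnt d (lv n) * K * mu n.+1 = 2 ^+ n * (lvcnt d (lv n) * K * mu n.+1) by ring.
by rewrite ler_peMr//; lra.
Qed.

(** The increments from [a] to [a + D n.+1] have quotients at least [N n.+1], which is at least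
    [2 ^+ n]. *)
Lemma drift_fun_not_holder (b : R) : Dz <= b - a -> ~ holder_space H `[a, b] drift_fun.
Proof.
move=> Dzb [_]; set S := ereal_sup _ => Soo.
have hS n : (((N n.+1)%:R : R)%:E <= S)%E.
  have D0 := lvD_gt0 n.+1; have D1 := lvD_le n; have Dz1 := lvD_succ_le 0.
  rewrite lv0/= in Dz1.
  have [Dz0 _] := andP Dz_itv.
  apply: (@le_trans _ _ ((enorm (drift_fun (a + D n.+1) - drift_fun a))%:E
      / (`|a + D n.+1 - a| `^ H)%:E)%E); last first.
    apply: ereal_sup_ubound; exists (a + D n.+1), a; split => //.
    - by rewrite /= in_itv/=; apply/andP; split; lra.
    - by rewrite /= in_itv/=; apply/andP; split; lra.
    - by rewrite -subr_eq0 addrAC subrr add0r gt_eqF.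
  have -> : a + D n.+1 - a = D n.+1 by ring.
  rewrite (gtr0_norm D0) inver gt_eqF ?powR_gt0// -EFinM lee_fin.
  rewrite ler_pdivlMr ?powR_gt0//.
  apply: le_trans (enorm_ge _ (Ordinal d_gt0)).
  rewrite !mxE /= subrr drift0 subr0.
  have -> : a + D n.+1 - a = D n.+1 by ring.
  by apply: le_trans (ler_norm _); exact: drift_D_ge.
have : S \is a fin_num.
  rewrite fin_numE -ltey Soo andbT; apply/eqP => e.
  by have := hS 0%N; rewrite e.
move=> /fineK Sfin.
have big n : 2 ^+ n <= fine S.
  rewrite -lee_fin Sfin; apply: le_trans (hS n); rewrite lee_fin.
  exact: pow2_le_lvN.
have S0 : 0 <= fine S by apply: le_trans (big 0%N); rewrite expr0.
have := big (Num.truncn (fine S)).+1.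
have /andP[_ h] := truncn_itv S0.
apply/negP; rewrite -ltNge; apply: (lt_le_trans h).
by rewrite -natrX ler_nat ltnW// ltn_expl.
Qed.

End Drift.

(** * The hitting event *)

Section HittingEvent.
Context (dO : measure_display) (Omega : measurableType dO) (R : realType).
Variables (d : nat) (X : R -> Omega -> 'rV[R]_d).
Hypothesis X_meas : forall t j, t \in `[0, 1] -> measurable_fun setT (fun w => X t w ord0 j).
Hypothesis X_cont : forall w j, {within `[0, 1], continuous (fun t => X t w ord0 j)}.

Lemma path_modulus w (t e : R) : 0 <= t <= 1 -> 0 < e -> exists2 del : R, 0 < del &
  forall u : R, 0 <= u <= 1 -> `|t - u| < del ->
    forall j, `|X t w ord0 j - X u w ord0 j| < e.
Proof.
move=> t01 e0.
have : \forall u \near t, forall j, u \in `[0, 1] -> `|X t w ord0 j - X u w ord0 j| < e.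
  have := @filter_forall _ _ (fun (j : 'I_d) (u : R) =>
    u \in `[0, 1] -> `|X t w ord0 j - X u w ord0 j| < e) (nbhs t) _.
  apply => j.
  have /subspace_continuousP/(_ t) := @X_cont w j.
  by rewrite /= in_itv/= => /(_ t01)/cvgrPdist_lt/(_ e e0).
move=> /nbhs_ballP[del /= del0 h]; exists del => // u u01 tu j.
by apply: h; rewrite // in_itv.
Qed.

(** Hitting is equivalent to a countable condition: for every [k], some rational time within
    [k.+1%:R^-1] of [E] has all coordinates of the path within [k.+1%:R^-1] of [A]. *)
Lemma measurable_hitting (E : set R) (A : set R) :
  compact E -> E `<=` `[0, 1] -> closed A ->
  measurable [set w | ((fun t => X t w) @` E)
                      `&` [set y | forall j, A (y ord0 j)] !=set0].
Proof.
move=> cE E01 cA.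
pose V k : set R := \bigcup_(e in E) ball e k.+1%:R^-1.
pose W k : set R := \bigcup_(z in A) ball z k.+1%:R^-1.
have Wopen k : open (W k) by apply: bigcup_open => z _; exact: ball_open.
pose G k (q : rat) : set Omega :=
  if `[< 0 <= (ratr q : R) <= 1 /\ V k (ratr q) >]
  then \bigcap_(j in [set: 'I_d]) (fun w => X (ratr q) w ord0 j) @^-1` W k
  else set0.
rewrite (_ : [set w | _] = \bigcap_k \bigcup_q G k q).
  apply: bigcapT_measurable => k; apply: bigcupT_measurable_rat => q; rewrite /G.
  case: asboolP => [[q01 _]|_]; last exact: measurable0.
  apply: fin_bigcap_measurable => // j _.
  rewrite -[X in measurable X]setTI; apply: X_meas => //.
  exact: open_measurable.
apply/seteqP; split => w.
  move=> [_ [[t Et <-] FX]] k _.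
  have t01 : 0 <= t <= 1 by have := E01 _ Et; rewrite /= in_itv.
  have k0 : 0 < k.+1%:R^-1 :> R by rewrite invr_gt0.
  have [del del0 hdel] := path_modulus w t01 k0.
  pose c := Num.min del k.+1%:R^-1.
  have c0 : 0 < c by rewrite lt_min del0.
  have lr : Num.max 0 (t - c) < Num.min 1 (t + c).
    by rewrite gt_max !lt_min; case/andP: t01 => ? ?; apply/andP; split; apply/andP; split; lra.
  have [q] := rat_in_itvoo lr; rewrite in_itv/= => /andP[].
  rewrite gt_max lt_min => /andP[q0 q1] /andP[q2 q3].
  have tq : `|t - ratr q| < c by rewrite ltr_norml; apply/andP; split; lra.
  have q01 : 0 <= (ratr q : R) <= 1 by apply/andP; split; lra.
  move: tq; rewrite lt_min => /andP[tq1 tq2].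
  exists q => //; rewrite /G; case: asboolP => [_|nq]; last by exfalso; apply: nq; split => //; exists t.
  move=> j _; exists (X t w ord0 j); first exact: FX.
  exact: hdel.
move=> wG.
have hk k : exists eq : R * R, [/\ E eq.1, 0 <= eq.2 <= 1, `|eq.1 - eq.2| < k.+1%:R^-1 &
    forall j, W k (X eq.2 w ord0 j)].
  have [q _] := wG k I; rewrite /G; case: asboolP => [[q01 [e Ee eq]] hj|//].
  by exists (e, ratr q); split => // j; exact: hj.
have [eq heq] := choice hk.
(* Compactness of [E] yields a limit time for the points of [E] near the rational times; path
   continuity and closedness of [A] then show that the path is in the target at that time. *)
have [t [Et tcl]] : E `&` cluster ((fun k => (eq k).1) @ \oo) !=set0.
  by apply: cE; exists 0%N => // k _; case: (heq k).
exists (X t w); split; first by exists t.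
move=> j; have t01 : 0 <= t <= 1 by have := E01 _ Et; rewrite /= in_itv.
apply: cA => U /nbhs_ballP[e /= e0 eU].
have e20 : 0 < e / 2 by rewrite divr_gt0.
have [del del0 hdel] := path_modulus w t01 e20.
pose c := Num.min (del / 2) (e / 2).
have c0 : 0 < c by rewrite lt_min !divr_gt0.
have [k0 hk0] : exists k0, forall k, (k0 <= k)%N -> k.+1%:R^-1 < c.
  have : \forall k \near \oo, k.+1%:R^-1 < c.
    have h : (k.+1%:R^-1 : R) @[k --> \oo] --> 0 by exact: cvg_harmonic.
    exact: cvgr_lt h _ c0.
  by move=> [k0 _ h]; exists k0 => k; exact: h.
have [_ [[k /= kk0 <-] tk]] :
    (fun k => (eq k).1) @` [set k | (k0 <= k)%N] `&` ball t (del / 2) !=set0.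
  apply: tcl; last by apply: nbhsx_ballx; rewrite divr_gt0.
  by exists k0 => // k kk; exists k.
have [_ q01 eqk hW] := heq k.
have [z Az zX] := hW j.
exists z; split => //; apply: eU.
have := hk0 _ kk0; rewrite lt_min => /andP[c1 c2].
have {}tk : `|t - (eq k).1| < del / 2 := tk.
have {}zX : `|z - X (eq k).2 w ord0 j| < k.+1%:R^-1 := zX.
rewrite /ball/=.
have hX : `|X t w ord0 j - X (eq k).2 w ord0 j| < e / 2.
  apply: hdel => //; rewrite -(subrK (eq k).1 t) -addrA.
  apply: (le_lt_trans (ler_normD _ _)); rewrite (splitr del) ltrD//.
  exact: lt_trans eqk c1.
rewrite -(subrK (X (eq k).2 w ord0 j) (X t w ord0 j)) -addrA.
apply: (le_lt_trans (ler_normD _ _)); rewrite (splitr e) ltrD//.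
by rewrite distrC; exact: lt_trans zX c2.
Qed.

End HittingEvent.

Lemma measure_bigsetU_le (R : realType) d (T : measurableType d)
    (mu : {measure set T -> \bar R}) (I : Type) (r : seq I) (A : I -> set T) (c : R) :
  (forall i, measurable (A i)) -> (forall i, (mu (A i) <= c%:E)%E) ->
  (mu (\big[setU/set0]_(i <- r) A i) <= ((size r)%:R * c)%:E)%E.
Proof.
move=> mA hA; elim: r => [|i r IH]; first by rewrite big_nil measure0 mul0r.
rewrite big_cons; apply: (@le_trans _ _ (mu (A i) + mu (\big[setU/set0]_(i <- r) A i))%E).
  by apply: measureU2 => //; exact: bigsetU_measurable.
by rewrite /= -natr1 mulrDl mul1r EFinD addeC leeD.
Qed.

Section GoodEvent.
Context (dO : measure_display) (Omega : measurableType dO) (R : realType).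
Variable P : probability Omega R.
Variables (d : nat) (H xi K Dz a : R) (lv : nat -> level R) (B : R -> Omega -> 'rV[R]_d).
Hypotheses (H01 : 0 < H < 1) (Dz_itv : 0 < Dz < 1).
Hypotheses (lv0 : lv 0%N = Level Dz 1 1 0)
  (lvS : forall n, next_level d H xi K n (lv n) (lv n.+1)).
Hypotheses (a_ge0 : 0 <= a) (aDz : a + Dz <= 1) (B_fbm : is_fbm P H B).

Local Notation D n := (lvD (lv n)).
Local Notation mu n := (lvmu (lv n)).
Local Notation r n := (lvr H (lv n)).
Local Notation sig n := (lvsig d (lv n)).

(** These are all the pairs of consecutive times that the search may select, whatever the path;
    controlling them all makes the event independent of the selection. *)
Definition admissible n (m m' : nat) := [&& m%:R * sig n <= 8 * D 1,
  m%:R * sig n <= m'%:R * sig n.+1 & m'%:R * sig n.+1 <= m%:R * sig n + 4 * D n.+1].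

Definition large_incr n (m m' : nat) (j : 'I_d) : set Omega :=
  [set w | 56 * (mu n.+1 * r n.+1) <
     `|B (a + m'%:R * sig n.+1) w ord0 j - B (a + m%:R * sig n) w ord0 j|].

Lemma admissible_itv n m m' : admissible n m m' ->
  (a + m%:R * sig n \in `[0, 1]) /\ (a + m'%:R * sig n.+1 \in `[0, 1]).
Proof.
case/and3P => h1 h2 h3; rewrite !in_itv/=.
have D1 := lvD_succ_le lvS 0; rewrite lv0/= in D1.
have Dn := lvD_le Dz_itv lv0 lvS n.
have p0 : 0 <= m%:R * sig n by rewrite mulr_ge0// ltW// (lvsig_gt0 Dz_itv lv0 lvS).
have a0 := a_ge0; have aD := aDz; have /andP[D0 _] := Dz_itv.
by split; apply/andP; split; lra.
Qed.

Lemma measurable_large_incr n m m' j : admissible n m m' ->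
  measurable (large_incr n m m' j).
Proof.
move=> /admissible_itv[h1 h2]; have [fb _] := B_fbm.
apply: measurable_gt_set; apply: measurableT_comp => //.
apply: measurable_funB.
  exact: (fbm_measurable (fb j) h2).
exact: (fbm_measurable (fb j) h1).
Qed.

Lemma large_incr_le n m m' j : admissible n m m' ->
  (P (large_incr n m m' j) <= (2 * expR (- mu n.+1 ^+ 2 / 4))%:E)%E.
Proof.
move=> adm; have [h1 h2] := admissible_itv adm; have [fb _] := B_fbm.
have /andP[H0 H1] := H01.
have mu1 := lvmu_ge1 lvS n.
have mu0 : 0 <= mu n.+1 by lra.
apply: le_trans (fbm_incr_tail H0 (fb j) h1 h2 mu0).
apply: le_measure; rewrite ?inE.
- exact: measurable_large_incr.
- apply: measurable_gt_set; apply: measurableT_comp => //; apply: measurable_funB.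
    exact: (fbm_measurable (fb j) h2).
  exact: (fbm_measurable (fb j) h1).
move=> w; rewrite /large_incr /=; apply: le_lt_trans.
have D0 := lvD_gt0 Dz_itv lv0 lvS n.+1; have r0 := lvr_gt0 Dz_itv lv0 lvS n.+1.
have hp : `|a + m'%:R * sig n.+1 - (a + m%:R * sig n)| `^ H <= 4 * r n.+1.
  have -> : a + m'%:R * sig n.+1 - (a + m%:R * sig n) = m'%:R * sig n.+1 - m%:R * sig n by ring.
  apply: (@le_trans _ _ ((4 * D n.+1) `^ H)).
    rewrite ge0_ler_powR ?nnegrE ?(ltW H0) ?mulr_ge0 ?(ltW D0)//.
    by case/and3P: adm => *; rewrite ger0_norm; lra.
  rewrite powRM ?(ltW D0)// ler_wpM2r ?(ltW r0)//.
  by rewrite -[leRHS]powRr1// ler_powR ?(ltW H1)//; lra.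
(* The constant 56 is [14 * 4]: [11 + 3 * mu <= 14 * mu] as [mu >= 1], and the step of length at
   most [4 * D] contributes [(4 * D)^H <= 4 * r]. *)
apply: (@le_trans _ _ (14 * mu n.+1 * (4 * r n.+1))); last by lra.
by apply: ler_pM; rewrite ?powR_ge0//; lra.
Qed.

(* An admissible [m'] is at distance less than [5 * N ^ d] from the index of
   the last point of the finer lattice before [m%:R * sig n]. *)
Definition bad n : set Omega := \big[setU/set0]_(p : 'I_(Num.truncn (sig n)^-1).+1 *
    'I_(5 * lvN (lv n.+1) ^ d) * 'I_d)
  (let m := p.1.1 : nat in
   let m' := (Num.truncn (m%:R * sig n / sig n.+1) + p.1.2)%N in
   if admissible n m m' then large_incr n m m' p.2 else set0).

Lemma measurable_bad n : measurable (bad n).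
Proof.
apply: bigsetU_measurable => p _ /=; case: ifP => // h.
exact: measurable_large_incr.
Qed.

Lemma bad_le n : (P (bad n) <= (8^-1 * 2^-1 ^+ n)%:E)%E.
Proof.
rewrite /bad -big_enum /=.
apply: le_trans (measure_bigsetU_le _ (c := 2 * expR (- mu n.+1 ^+ 2 / 4)) _ _) _.
- by move=> p /=; case: ifP => // h; exact: measurable_large_incr.
- move=> p /=; case: ifP => h; first exact: large_incr_le.
  by rewrite measure0 lee_fin mulr_ge0// expR_ge0.
rewrite lee_fin -cardE !card_prod !card_ord.
rewrite mulrC [leRHS]mulrC; apply: le_trans (next_tail (lvS n)).
rewrite mulrC ler_wpM2r ?mulr_ge0 ?expR_ge0//.
have s0 := lvsig_gt0 Dz_itv lv0 lvS n.
have hT : (Num.truncn (sig n)^-1).+1%:R <= lvcnt d (lv n).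
  have si0 : 0 <= (sig n)^-1 by rewrite invr_ge0 ltW.
  by have /andP[h _] := truncn_itv si0; rewrite -natr1 /lvcnt; lra.
rewrite !natrM natrX /lvQ -[leRHS]mulrA [leRHS]mulrC ler_wpM2r//.
by rewrite ler_wpM2r// mulr_ge0// exprn_ge0.
Qed.

Lemma not_bad_incr n m m' j w : (~ bad n w) -> admissible n m m' ->
  `|B (a + m'%:R * sig n.+1) w ord0 j - B (a + m%:R * sig n) w ord0 j|
    <= 56 * (mu n.+1 * r n.+1).
Proof.
move=> nb adm; rewrite leNgt; apply/negP => h; apply: nb.
have s0 := lvsig_gt0 Dz_itv lv0 lvS n; have s1 := lvsig_gt0 Dz_itv lv0 lvS n.+1.
have D0 := lvD_gt0 Dz_itv lv0 lvS n.+1.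
have si0 : 0 <= (sig n)^-1 by rewrite invr_ge0 ltW.
have /and3P[h1 h2 h3] := adm.
have mlt : (m < (Num.truncn (sig n)^-1).+1)%N.
  rewrite ltnS truncn_ge_nat//.
  rewrite -(ler_pM2r s0) mulVf ?gt_eqF//.
  have D1 := lvD_succ_le lvS 0; rewrite lv0/= in D1.
  by have /andP[_ Dz1] := Dz_itv; lra.
pose x := m%:R * sig n / sig n.+1.
have x0 : 0 <= x by apply: divr_ge0; [apply: mulr_ge0 => //; exact: ltW|exact: ltW].
have /andP[x1 x2] := truncn_itv x0.
have xm : x <= m'%:R by rewrite ler_pdivrMr.
have mx : m'%:R <= x + 4 * lvQ d (lv n.+1).
  rewrite -(ler_pM2r s1) mulrDl divfK ?gt_eqF// (le_trans h3)// lerD2l.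
  have e : lvQ d (lv n.+1) * sig n.+1 = D n.+1.
    by rewrite /lvsig mulrC divfK// gt_eqF// (lvQ_gt0 lv0 lvS).
  by rewrite -mulrA e.
have tm : (Num.truncn x <= m')%N by rewrite -(ler_nat R); exact: le_trans x1 xm.
have Q1 : 1 <= lvQ d (lv n.+1) by rewrite exprn_ege1// ler1n (lvN_gt0 lv0 lvS).
have ilt : (m' - Num.truncn x < 5 * lvN (lv n.+1) ^ d)%N.
  rewrite -(ltr_nat R) natrB// natrM natrX -/(lvQ d (lv n.+1)).
  by move: x2; rewrite -natr1; lra.
rewrite /bad -big_enum /= -bigcup_seq.
exists ((Ordinal mlt, Ordinal ilt), j); first by rewrite /= mem_enum.
by rewrite /= -/x subnKC// adm.
Qed.

Variable M0 : R.
Hypothesis M0_tail : forall j, (P [set w | (M0 < `|B a w ord0 j|)%R] <= ((4 * d%:R)^-1)%:E)%E.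

Lemma good_event : (0 < d)%N -> exists G : set Omega, [/\ measurable G, (0 < P G)%E &
  forall w, G w -> (forall j, `|B a w ord0 j| <= M0) /\
    forall n m m' j, admissible n m m' ->
  `|B (a + m'%:R * sig n.+1) w ord0 j - B (a + m%:R * sig n) w ord0 j|
    <= 56 * (mu n.+1 * r n.+1)].
Proof.
move=> d0.
pose bad0 : set Omega := \big[setU/set0]_(j < d) [set w | M0 < `|B a w ord0 j|].
have [fb _] := B_fbm.
have mj j : measurable [set w | M0 < `|B a w ord0 j|].
  apply: measurable_gt_set; apply: measurableT_comp => //.
  apply: (fbm_measurable (fb j)); rewrite in_itv/=.
  by have := a_ge0; have := aDz; have /andP[? ?] := Dz_itv; move=> *; apply/andP; split; lra.
have mb0 : measurable bad0 by exact: bigsetU_measurable.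
have mbad : measurable (\bigcup_n bad n).
  by apply: bigcupT_measurable => n; exact: measurable_bad.
have Pb0 : (P bad0 <= (4^-1)%:E)%E.
  rewrite /bad0 -big_enum /=.
  apply: le_trans (measure_bigsetU_le _ mj M0_tail) _.
  rewrite lee_fin -cardE card_ord invfM mulrCA mulfV ?mulr1// pnatr_eq0 -lt0n//.
have Pb : (P (\bigcup_n bad n) <= (4^-1)%:E)%E.
  apply: (le_trans (measure_sigma_subadditive _ (fun n => measurable_bad n) mbad (@subset_refl _ _))).
  apply: lime_le; first by apply: is_cvg_nneseries => n _ _; exact: measure_ge0.
  apply: nearW => n; apply: le_trans (_ : \sum_(0 <= i < n) (8^-1 * 2^-1 ^+ i)%:E <= _)%E.
    by apply: lee_sum => i _; exact: bad_le.
  have h8 : 0 <= 8^-1 :> R by rewrite invr_ge0.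
  have h2 : 0 <= (2^-1 : R) < 1 by apply/andP; split; lra.
  rewrite sumEFin lee_fin; apply: (le_trans (sum_geometric_le _ h8 h2)).
  by rewrite le_eqVlt; apply/orP; left; apply/eqP; field.
exists (~` (bad0 `|` \bigcup_n bad n)); split.
- by apply: measurableC; exact: measurableU.
- rewrite probability_setC; last exact: measurableU.
  have : (P (bad0 `|` \bigcup_n bad n) <= (2^-1)%:E)%E.
    apply: (@le_trans _ _ (P bad0 + P (\bigcup_n bad n))%E); first exact: measureU2.
    rewrite (_ : (2^-1)%:E = (4^-1)%:E + (4^-1)%:E)%E; last by rewrite -EFinD; congr (_%:E); lra.
    exact: leeD.
  move=> h; rewrite sube_gt0; apply: (le_lt_trans h).
  by rewrite lte_fin invf_lt1//; lra.
- move=> w /not_orP[nb0 nb]; split.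
    move=> j; rewrite leNgt; apply/negP => h; apply: nb0.
    by rewrite /bad0 -big_enum /= -bigcup_seq; exists j; rewrite /= ?mem_enum.
  by move=> n m m' j; apply: not_bad_incr => bn; apply: nb; exists n.
Qed.

End GoodEvent.

Section Hitting.
Context (dO : measure_display) (Omega : measurableType dO) (R : realType).
Variable P : probability Omega R.
Variables (d : nat) (H xi K Dz a M0 : R) (lv : nat -> level R) (B : R -> Omega -> 'rV[R]_d).
Hypotheses (H01 : 0 < H < 1) (Dz_itv : 0 < Dz < 1) (K_ge : 100 <= K) (xi01 : 0 < xi < 1).
Hypotheses (lv0 : lv 0%N = Level Dz 1 1 0)
  (lvS : forall n, next_level d H xi K n (lv n) (lv n.+1)).
Hypotheses (a_ge0 : 0 <= a) (aDz : a + Dz <= 1) (B_fbm : is_fbm P H B).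
Hypotheses (d_gt0 : (0 < d)%N).
Hypothesis M0_tail : forall j, (P [set w | (M0 < `|B a w ord0 j|)%R] <= ((4 * d%:R)^-1)%:E)%E.

Local Notation D n := (lvD (lv n)).
Local Notation E := (@time_target R d lv a).
Local Notation F := (@space_target R d H lv (M0 + 1)).
Local Notation f := (@drift_fun R d H lv a).
Local Notation event := [set w | ((fun t => (B t w + f t)%R) @` E) `&` F !=set0].

Lemma time_target_itv t : E t -> a <= t <= a + Dz / 2.
Proof.
move=> [/= /andP[t0 t1] _]; have D1 := lvD_succ_le lvS 0; rewrite lv0/= in D1.
by have /andP[Dz0 _] := Dz_itv; apply/andP; split; lra.
Qed.

Lemma time_target_compact : compact E.
Proof.
have -> : E = (fun t => t + a) @` @time_set R d lv.
  apply/seteqP; split => t.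
    by move=> Et; exists (t - a) => //; rewrite subrK.
  by move=> [u Eu <-]; rewrite /time_target /= addrK.
apply: continuous_compact; last exact: time_set_compact Dz_itv lv0 lvS.
apply: continuous_subspaceT => t; apply: cvgD; [exact: cvg_id|exact: cvg_cst].
Qed.

Lemma space_target_compact : compact F.
Proof.
apply: (@rV_compact _ _ (fun=> @space_set R H lv (M0 + 1))) => j.
exact: space_set_compact Dz_itv lv0 lvS _.
Qed.

Lemma fbm_coord_measurable t j : t \in `[0, 1] -> measurable_fun setT (fun w => B t w ord0 j).
Proof. by move=> t01; have [fb _] := B_fbm; exact: (fbm_measurable (fb j) t01). Qed.

Lemma fbm_coord_continuous w j : {within `[0, 1], continuous (fun t => B t w ord0 j)}.
Proof. by have [fb _] := B_fbm; case: (fb j). Qed.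

Lemma measurable_event : measurable event.
Proof.
apply: (measurable_hitting (X := fun t w => B t w + f t)).
- move=> t j t01.
  rewrite (_ : (fun w => _) = fun w => B t w ord0 j + f t ord0 j); last first.
    by apply/funext => w; rewrite mxE.
  apply: measurable_funD; first exact: fbm_coord_measurable.
  exact: measurable_cst.
- move=> w j.
  rewrite (_ : (fun t => _) = fun t => B t w ord0 j + drift H lv (t - a) j); last first.
    by apply/funext => t; rewrite !mxE.
  have cf : {within `[0, 1], continuous (fun t : R => drift H lv (t - a) j)}.
    apply: continuous_subspaceT.
    by move=> t; apply: (@drift_shift_continuous R d H xi K Dz lv H01 Dz_itv lv0 lvS a xi01 j (ltn_ord j)).
  move=> t; apply: cvgD; [exact: fbm_coord_continuous|exact: cf].
- exact: time_target_compact.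
- move=> t /time_target_itv /andP[t0 t1]; rewrite /= in_itv/=.
  have /andP[Dz0 _] := Dz_itv; have aD := aDz; have a0 := a_ge0.
  by apply/andP; split; lra.
- apply: compact_closed; first exact: Rhausdorff.
  exact: space_set_compact Dz_itv lv0 lvS _.
Qed.

Lemma event_gt0 : (0 < P event)%E.
Proof.
have [G [mG PG hG]] := good_event H01 Dz_itv lv0 lvS a_ge0 aDz B_fbm M0_tail d_gt0.
apply: (lt_le_trans PG); apply: le_measure; rewrite ?inE//; first exact: measurable_event.
move=> w /hG[h0 hincr].
(* The search indexes coordinates by natural numbers; indices from [d] on receive the value 0. *)
pose beta (t : R) (j : nat) := if insub j is Some i then B (a + t) w ord0 i else 0.
have betaE t (j : 'I_d) : beta t j = B (a + t) w ord0 j by rewrite /beta valK.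
have D1 := lvD_succ_le lvS 0; rewrite lv0/= in D1.
have [j jd|n m m' j jd h1 h2|u t j jd hu ht cu|t Et ht] :=
  @hit R d H xi K Dz lv H01 Dz_itv K_ge lv0 lvS beta M0.
- rewrite -[j]/(val (Ordinal jd)) betaE addr0; exact: h0.
- rewrite -[j]/(val (Ordinal jd)) !betaE; apply: hincr.
  by rewrite /admissible h1.
- rewrite -[j]/(val (Ordinal jd)) betaE; under eq_fun do rewrite betaE.
  have itv01 v : 0 <= v <= 8 * D 1 -> 0 <= a + v <= 1.
    move=> /andP[v0 v1]; have /andP[Dz0 _] := Dz_itv; have aD := aDz; have a0 := a_ge0.
    by apply/andP; split; lra.
  apply/cvgrPdist_lt => e e0.
  have [del del0 hdel] := path_modulus fbm_coord_continuous w (itv01 _ ht) e0.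
  near=> n; apply: hdel; first exact: itv01.
  have -> : a + t - (a + u n) = t - u n by rewrite opprD addrACA subrr add0r.
  by near: n; move/cvgrPdist_lt: cu; exact.
exists (B (a + t) w + f (a + t)); split.
  exists (a + t) => //; rewrite /time_target /= (_ : a + t - a = t)//.
  by rewrite addrAC subrr add0r.
move=> j; rewrite !mxE (_ : a + t - a = t); last by rewrite addrAC subrr add0r.
by rewrite -betaE; exact: ht.
Unshelve. all: by end_near. Qed.

End Hitting.

Theorem theorem4p3 (R : realType) (dO : measure_display)
    (Omega : measurableType dO) (P : probability Omega R)
    (P_complete : measure_is_complete P)
    (a b : R) (a_gt0 : 0 < a) (a_lt_b : a < b) (b_le1 : b <= 1)
    (d : nat) (d_gt0 : (0 < d)%N) (H : R) (H_gt0 : 0 < H) (H_lt1 : H < 1)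
    (B : R -> Omega -> 'rV[R]_d) (B_fbm : is_fbm P H B)
    (theta L eps : R -> R) (c1 x0 : R)
    (theta_rv : normalized_regvar H theta L eps c1 x0)
    (L_liminf : limf_einf (fun x : R => (L x)%:E) (pinfty_nbhs R) = 0%E)
    (L_limsup : (limf_esup (fun x : R => (L x)%:E) (pinfty_nbhs R) < +oo)%E)
    (eps_limsup :
      limf_esup (fun x : R => (x * derive1 eps x)%:E) (pinfty_nbhs R) = 0%E) :
  exists (f : R -> 'rV[R]_d) (E : set R) (F : set 'rV[R]_d),
    [/\ modulus_space (w_ell H L) `[a, b] f /\ ~ holder_space H `[a, b] f,
        [/\ compact E, E `<=` `[a, b] & compact F],
        capacity (@parabolic_dist R d H) d%:R (E `*` F) = 0%E,
        hausdorff_measure (@parabolic_space R d) (@parabolic_dist R d H) d%:R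
          (E `*` F) = 0%E
      & (0 < P [set w | ((fun t => (B t w + f t)%R) @` E) `&` F !=set0])%E].
Proof.
have H01 : 0 < H < 1 by rewrite H_gt0.
pose xi := b - a; have xi01 : 0 < xi < 1 by apply/andP; split; rewrite /xi; lra.
(* The bound by [xi] keeps [E] and the times used against [C^H] inside [[a, b]]; the bound by [a]
   gives [16 * D 1 <= a]. *)
pose Dz := Num.min xi a.
have Dz_itv : 0 < Dz < 1.
  by rewrite lt_min gt_min a_gt0; case/andP: xi01 => -> ->.
have Dzxi : Dz <= xi by rewrite ge_min lexx.
have Dza : Dz <= a by rewrite ge_min lexx orbT.
have dR : 0 < d%:R :> R by rewrite ltr0n.
have eps0 : 0 < (4 * d%:R)^-1 :> R by rewrite invr_gt0 mulr_gt0.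
(* In dimension 0 the lemma reduces to the choice of [mu0] with [2 * expR (- mu0 ^+ 2 / 4)] at most
   the given bound. *)
have [mu0 [N0 [mu1 _ _ htail]]] := @exists_tail_size R 0 0 2 _ (lexx 0) (ler0n _ _) eps0.
pose M0 := (11 + 3 * mu0) * a `^ H.
have mu00 : 0 <= mu0 by lra.
have M0_ge0 : 0 <= M0 by rewrite mulr_ge0 ?powR_ge0//; lra.
have [fb _] := B_fbm.
have M0_tail j : (P [set w | (M0 < `|B a w ord0 j|)%R] <= ((4 * d%:R)^-1)%:E)%E.
  have a01 : 0 < a <= 1 by apply/andP; split; lra.
  apply: le_trans (fbm_tail H_gt0 (fb j) a01 mu00) _.
  by move: htail; rewrite expr0 mulr1 lee_fin.
(* [K] has to be known before the levels are built. This is possible because [M0] depends only on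
   the law of the starting value [B a]. *)
pose K := 500 * d%:R * (2 * (M0 + 1) + 5) + 100.
have K0 : 0 <= 500 * d%:R * (2 * (M0 + 1) + 5).
  by rewrite mulr_ge0 ?mulr_ge0 ?(ltW dR)//; lra.
have K_ge : 100 <= K by rewrite /K lerDr.
have K_ge0 : 0 <= K by lra.
have [Dz0 Dz1] := andP Dz_itv.
have [lv [lv0 lvS]] := @levels_exist R d H xi K H01 xi01 K_ge0 Dz Dz0.
have D1 := lvD_succ_le lvS 0; rewrite lv0/= in D1.
have D1a : 16 * lvD (lv 1%N) <= a by lra.
have M_ge0 : 0 <= M0 + 1 by lra.
have K_big : 500 * d%:R * (2 * (M0 + 1) + 5) <= K by rewrite /K; lra.
have [c c0 hc] := w_ell_ge theta_rv H_gt0 L_limsup H_lt1.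
have aDz : a + Dz <= 1 by move: Dzxi; rewrite /xi; lra.
exists (@drift_fun R d H lv a), (@time_target R d lv a), (@space_target R d H lv (M0 + 1)); split.
- split.
    exact: (drift_fun_modulus H01 Dz_itv lv0 lvS xi01 (lexx _) c0 hc).
  by move=> /(drift_fun_not_holder Dz_itv K_ge lv0 lvS d_gt0 Dzxi).
- split.
  + exact: time_target_compact Dz_itv lv0 lvS.
  + move=> t /(time_target_itv Dz_itv lv0 lvS)/andP[t0 t1]; rewrite /= in_itv/= t0/=.
    by move: Dzxi; rewrite /xi; lra.
  + exact: space_target_compact Dz_itv lv0 lvS.
- by have := target_capacity H01 Dz_itv K_ge lv0 lvS d_gt0 M_ge0 K_big D1a.
- by have := target_hausdorff H01 Dz_itv K_ge lv0 lvS d_gt0 M_ge0 K_big D1a.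
- by have := event_gt0 H01 Dz_itv K_ge xi01 lv0 lvS (ltW a_gt0) aDz B_fbm d_gt0 M0_tail.
Qed.
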